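(* Let $\mathfrak g=\mathfrak g_0\oplus\mathfrak g_1$ be a finite-dimensional quasireductive Lie superalgebra over $\mathbb C$. Assume that there exists an element $h$ in the center of $\mathfrak g_0$ such that $\operatorname{ad}_h$ acts diagonally on $\mathfrak g_1$ with nonzero real eigenvalues. Let $M$ be an object of $\mathcal F(\mathfrak g)$. If $X_M=\{0\}$, then $M$ is projective in $\mathcal F(\mathfrak g)$.
   Context: A finite-dimensional Lie superalgebra $\mathfrak g=\mathfrak g_0\oplus\mathfrak g_1$ over $\mathbb C$ is quasireductive if $\mathfrak g_0$ is a reductive Lie algebra and $\mathfrak g_1$ is a semisimple $\mathfrak g_0$-module. $\mathcal F(\mathfrak g)$ is the category of finite-dimensional ($\mathbb Z_2$-graded) $\mathfrak g$-modules that are semisimple over $\mathfrak g_0$. Let $X=\{x\in\mathfrak g_1 : [x,x]=0\}$. For a $\mathfrak g$-module $M$ and $x\in X$, $x$ acts on $M$ with square zero, and $M_x:=\operatorname{Ker}(x|_M)/xM$. The associated variety of $M$ is $X_M=\{x\in X : M_x\neq 0\}$. *)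

(* Defs.v *)
From mathcomp Require Import all_boot all_order all_algebra.
From mathcomp Require Import boolp classical_sets reals.
From mathcomp Require Import complex.

Set Implicit Arguments.
Unset Strict Implicit.
Unset Printing Implicit Defensive.

Import GRing.Theory Num.Theory.

Local Open Scope ring_scope.
Local Open Scope classical_set_scope.

(* Parities are booleans (false = even, true = odd), so that parities add by
   (+) and the sign (-1)^(ab) is (-1) ^+ (a && b). *)
Record lieSuperalgebra (K : numFieldType) := LieSuperalgebra {
  ls_sort :> vectType K;
  ls_part : bool -> {vspace ls_sort};
  ls_br : 'Hom(ls_sort, 'Hom(ls_sort, ls_sort));
  ls_part_cap : (ls_part false :&: ls_part true = 0)%VS;
  ls_part_sum : (ls_part false + ls_part true = fullv)%VS;
  ls_br_part : forall a b x y,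
    x \in ls_part a -> y \in ls_part b -> ls_br x y \in ls_part (a (+) b);
  ls_br_skew : forall a b x y,
    x \in ls_part a -> y \in ls_part b ->
    ls_br x y = - ((-1) ^+ (a && b) *: ls_br y x);
  ls_br_jacobi : forall a b c x y z,
    x \in ls_part a -> y \in ls_part b -> z \in ls_part c ->
    ls_br x (ls_br y z)
      = ls_br (ls_br x y) z + (-1) ^+ (a && b) *: ls_br y (ls_br x z)
}.

Record superModule (K : numFieldType) (g : lieSuperalgebra K) := SuperModule {
  sm_sort :> vectType K;
  sm_part : bool -> {vspace sm_sort};
  sm_act : 'Hom(g, 'End(sm_sort));
  sm_part_cap : (sm_part false :&: sm_part true = 0)%VS;
  sm_part_sum : (sm_part false + sm_part true = fullv)%VS;
  sm_act_part : forall a b x v,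
    x \in ls_part g a -> v \in sm_part b -> sm_act x v \in sm_part (a (+) b);
  sm_act_br : forall a b x y v,
    x \in ls_part g a -> y \in ls_part g b ->
    sm_act (ls_br g x y) v
      = sm_act x (sm_act y v) - (-1) ^+ (a && b) *: sm_act y (sm_act x v)
}.

Section Definitions.
Variables (K : numFieldType) (g : lieSuperalgebra K).

Local Notation g0 := (ls_part g false).
Local Notation g1 := (ls_part g true).

Section EvenModules.
Variables (V : vectType K) (rho : 'Hom(g, 'End(V))).

Definition even_stable (W : {vspace V}) : Prop :=
  forall x, x \in g0 -> (rho x @: W <= W)%VS.

Definition even_simple (W : {vspace V}) : Prop :=
  [/\ W != 0%VS, even_stable W &
      forall U, (U <= W)%VS -> even_stable U -> U = 0%VS \/ U = W].

Definition even_semisimple (W : {vspace V}) : Prop :=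
  exists (n : nat) (S : 'I_n -> {vspace V}),
    [/\ forall i, even_simple (S i),
        directv (\sum_i S i)%VS & (\sum_i S i)%VS = W].

End EvenModules.

(* A Lie algebra is reductive when its adjoint representation is semisimple. *)
Definition quasireductive : Prop :=
  even_semisimple (ls_br g) g0 /\ even_semisimple (ls_br g) g1.

Definition in_even_center (h : g) : Prop :=
  h \in g0 /\ forall y, y \in g0 -> ls_br g h y = 0.

(* The objects of F(g). *)
Definition inF (M : superModule g) : Prop :=
  even_semisimple (sm_act M) fullv.

(* The morphisms of F(g) preserve parity. *)
Definition is_morphism (M N : superModule g) (f : 'Hom(M, N)) : Prop :=
  (forall a v, v \in sm_part M a -> f v \in sm_part N a) /\
  (forall x v, f (sm_act M x v) = sm_act N x (f v)).

(* Epimorphisms of F(g) are the surjective morphisms. *)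
Definition projective_inF (M : superModule g) : Prop :=
  inF M /\
  forall (N L : superModule g) (p : 'Hom(N, L)) (f : 'Hom(M, L)),
    inF N -> inF L -> is_morphism p -> is_morphism f -> limg p = fullv ->
    exists q : 'Hom(M, N), is_morphism q /\ (p \o q)%VF = f.

Definition self_commuting_cone : set g :=
  [set x | x \in g1 /\ ls_br g x x = 0].

(* Ker x / xM, realized as a complement of xM in Ker x (for x in the
   self-commuting cone, xM is contained in Ker x). *)
Definition ds_fiber (M : superModule g) (x : g) : {vspace M} :=
  (lker (sm_act M x) :\: limg (sm_act M x))%VS.

Definition associated_variety (M : superModule g) : set g :=
  [set x | self_commuting_cone x /\ ds_fiber M x <> 0%VS].

End Definitions.

Definition acts_diagonally_on_odd_nonzero_real (R : realType)
    (g : lieSuperalgebra R[i]) (h : g) : Prop :=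
  exists (n : nat) (e : n.-tuple g) (a : 'I_n -> R),
    basis_of (ls_part g true) e /\
    forall i, a i != 0 /\
      ls_br g h (tnth e i) = (a i)%:C%C *: tnth e i.

(* Main.v *)
Require Import Defs.
From HB Require Import structures.
From mathcomp Require Import all_boot all_order all_algebra.
From mathcomp Require Import boolp classical_sets reals.
From mathcomp Require Import complex.

(* The eigenspaces of ad h split g1 = g+ + g- according to the sign of the
   eigenvalue, and centrality of h in g0 makes g+ and g- supercommutative, so
   that every element of g+ and g- squares to zero on M.
   - Hence ker x = xM for all nonzero x in g+ or g-, and a Dade-type argument
     makes M free over the exterior algebras of g+ and g-: writing w+ and w- for
     the top products, the vectors killed by g+ are w+ M, and ker w- = g- M.
   - For f in End(M) on which g0 acts by the inverse of the character of
     w- w+, the relative trace Tr f = w- w+ f is a g-morphism. If id = Tr f then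
     M is projective: a morphism q is lifted by Tr (s f), s a g0-lift of q.
   - To reach id, take psi = 1 - Tr f of small rank. On the eigenspace V of h in
     psi M with maximal eigenvalue, w- is injective and V is contained in w+ M.
     The map f sending w- v to a preimage of v under w+ then satisfies
     Tr f v = +-v, which allows one to lower the rank of psi. *)

Set Implicit Arguments.
Unset Strict Implicit.
Unset Printing Implicit Defensive.

Import Order.TTheory GRing.Theory Num.Theory.

Local Open Scope ring_scope.

(** * Eigenvectors *)

Section LinearAlgebra.
Import VectorInternalTheory.
Variable K : numClosedFieldType.
Implicit Types V : vectType K.

Lemma limgP (F : fieldType) (V W : vectType F) (f : 'Hom(V, W)) (w : W) :
  reflect (exists v, w = f v) (w \in limg f).
Proof.
apply: (iffP memv_imgP) => [[v _ ->]|[v ->]]; first by exists v.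
by exists v; rewrite ?memvf.
Qed.

Lemma lfun_mxE V (f : 'End(V)) v : v2r (f v) = v2r v *m f2mx f.
Proof. by rewrite unlock /= r2vK. Qed.

Lemma eigen_root V (f : 'End(V)) v c :
  f v = c *: v -> v != 0 -> root (char_poly (f2mx f)) c.
Proof.
move=> fv v0; rewrite -eigenvalue_root_char; apply/eigenvalueP; exists (v2r v).
  by rewrite -lfun_mxE fv linearZ.
by apply: contraNneq v0 => v0; rewrite -[v]v2rK v0 linear0.
Qed.

Lemma exists_eigenvector V (f : 'End(V)) :
  (0 < \dim {:V})%N -> exists c v, f v = c *: v /\ v != 0.
Proof.
rewrite dimvf => V0; have [c /eigenvalueP[v fv v0]] := eigenvalue_closed (f2mx f) V0.
exists c, (r2v v); split; last first.
  by apply: contraNneq v0 => v0; rewrite -[v]r2vK v0 linear0.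
by apply: v2r_inj; rewrite lfun_mxE linearZ /= r2vK fv.
Qed.

Lemma exists_eigenvector_in V (f : 'End(V)) (W : {vspace V}) :
  (f @: W <= W)%VS -> W != 0%VS ->
  exists c v, [/\ v \in W, f v = c *: v & v != 0].
Proof.
move=> fW W0; pose k := (projv W \o f \o linfun (vsval : subvs_of W -> V))%VF.
pose h : 'End(subvs_of W) := (linfun (vsproj W) \o k)%VF.
have hE u : vsval (h u) = f (vsval u).
  rewrite /h /k !comp_lfunE !lfunE /= vsprojK ?memv_proj //.
  by rewrite projv_id // (subvP fW) // memv_img // subvsP.
have [|c [u [hu u0]]] := exists_eigenvector h.
  by rewrite dimvf lt0n dimv_eq0.
exists c, (vsval u); split; rewrite ?subvsP //; first by rewrite -hE hu.
Qed.

(** An eigenvector of the map induced by [f] on (Z + B) / B: the quotient is modelled by the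
    complement [Z :\: B], to which [f] is compressed by projecting along [B]. *)
Lemma exists_eigenvector_mod V (f : 'End(V)) (Z B : {vspace V}) :
  (f @: Z <= Z)%VS -> (f @: B <= B)%VS -> ~~ (Z <= B)%VS ->
  exists c v, [/\ v \in Z, f v - c *: v \in B & v \notin B].
Proof.
move=> fZ fB ZB; pose C := (Z :\: B)%VS.
have C0 : C != 0%VS by rewrite diffv_eq0.
pose h := (addv_pi1 Z B \o f)%VF.
have hC : (h @: C <= C)%VS.
  by apply/subvP => _ /memv_imgP[u _ ->]; rewrite comp_lfunE; apply: memv_pi.
have [c [v [vC hv v0]]] := exists_eigenvector_in hC C0.
have vZ : v \in Z by apply: (subvP (diffvSl Z B)).
exists c, v; split => //.
  have /addv_pi1_pi2 : f v \in (Z + B)%VS.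
    by rewrite (subvP (addvSl _ _)) // (subvP fZ) // memv_img.
  by move: hv; rewrite comp_lfunE => -> <-; rewrite addrC addKr; apply: memv_pi2.
apply: contra v0 => vB; have : v \in (C :&: B)%VS by rewrite memv_cap vC.
by rewrite capv_diff memv0.
Qed.

(** The order of [K] is only partial, so maximality means that nothing in the list is strictly
    larger. *)
Lemma exists_maximal (s : seq K) (P : pred K) :
  (exists2 x, x \in s & P x) ->
  exists x, P x /\ forall y, y \in s -> P y -> ~~ (x < y).
Proof.
elim: s => [|a s IHs]; first by case.
case=> x0 x0s Px0; have [/hasP/IHs[x [Px xmax]]|/hasPn noP] := boolP (has P s).
  have [xa|xa] := boolP (P a && (x < a)).
    case/andP: xa => Pa xa; exists a; split=> // y; rewrite inE => /predU1P[->|ys Py].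
      by rewrite ltxx.
    by apply: contra (xmax y ys Py); apply: lt_trans.
  exists x; split=> // y; rewrite inE => /predU1P[->|]; last exact: xmax.
  by move=> Pa; move: xa; rewrite Pa.
have Pa : P a.
  by move: x0s; rewrite inE => /predU1P[<-|/noP]; rewrite ?Px0.
exists a; split=> // y; rewrite inE => /predU1P[->|/noP/negPf->//].
by rewrite ltxx.
Qed.

(** Eigenvalues are roots of the characteristic polynomial, so they lie in a finite list, where a
    maximal one can be picked. *)
Lemma exists_maximal_eigenvalue V (f : 'End(V)) (W : {vspace V}) :
  (f @: W <= W)%VS -> W != 0%VS ->
  exists c, (exists v, [/\ v \in W, f v = c *: v & v != 0]) /\
    forall d v, v \in W -> f v = d *: v -> v != 0 -> ~~ (c < d).
Proof.
move=> fW W0.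
have [r rE] := closed_field_poly_normal (char_poly (f2mx f)).
have rP c v : f v = c *: v -> v != 0 -> c \in r.
  move=> fv v0; have := eigen_root fv v0.
  rewrite rE (monicP (char_poly_monic _)) scale1r.
  by rewrite root_prod_XsubC.
pose P c := (W :&: lker (f - c *: \1%VF) != 0)%VS.
have PP c : reflect (exists v, [/\ v \in W, f v = c *: v & v != 0]) (P c).
  apply: (iffP idP) => [P0|[v [vW fv v0]]].
    exists (vpick (W :&: lker (f - c *: \1%VF))%VS).
    have := memv_pick (W :&: lker (f - c *: \1%VF))%VS.
    rewrite memv_cap memv_ker add_lfunE opp_lfunE scale_lfunE id_lfunE subr_eq0.
    by case/andP=> ? /eqP ?; split; rewrite ?vpick0.
  apply: contraNneq v0 => E.
  have : v \in (W :&: lker (f - c *: \1%VF))%VS.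
    by rewrite memv_cap vW memv_ker add_lfunE opp_lfunE scale_lfunE id_lfunE fv subrr eqxx.
  by rewrite E memv0.
have [|c [/PP Pc cmax]] := @exists_maximal r P.
  have [c [v [vW fv v0]]] := exists_eigenvector_in fW W0.
  by exists c; [exact: rP fv v0|apply/PP; exists v].
exists c; split=> // d v vW fv v0; apply: cmax; first exact: rP fv v0.
by apply/PP; exists v.
Qed.

End LinearAlgebra.

(** * Exactness over exterior algebras *)

Section Pencil.
Variable K : numClosedFieldType.

(** The two-variable case of the Dade-type argument: if every nonzero combination of the
    anticommuting [X] and [Y] is exact on [N], then [Y] is exact on X N. Algebraic closedness enters
    through an eigenvector. *)
Lemma exact_pencil (V : vectType K) (X Y : 'End(V)) (N : {vspace V}) :
  (forall v, X (X v) = 0) -> (forall v, Y (Y v) = 0) ->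
  (forall v, X (Y v) = - Y (X v)) ->
  (X @: N <= N)%VS -> (Y @: N <= N)%VS ->
  (forall a b : K, (a != 0) || (b != 0) -> forall v, v \in N ->
     a *: X v + b *: Y v = 0 ->
     exists2 w, w \in N & v = a *: X w + b *: Y w) ->
  forall v, v \in N -> Y (X v) = 0 ->
  exists2 w, w \in N & X v = Y (X w).
Proof.
move=> XX YY XY XN YN exN.
have exX v : v \in N -> X v = 0 -> exists2 w, w \in N & v = X w.
  move=> vN Xv; have [||w wN ->] := exN 1 0 _ v vN; rewrite ?oner_eq0 //.
    by rewrite scale1r scale0r Xv addr0.
  by exists w => //; rewrite scale1r scale0r addr0.
have exY v : v \in N -> Y v = 0 -> exists2 w, w \in N & v = Y w.
  move=> vN Yv; have [||w wN ->] := exN 0 1 _ v vN; rewrite ?oner_eq0 ?orbT //.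
    by rewrite scale1r scale0r Yv addr0.
  by exists w => //; rewrite scale1r scale0r add0r.
have inXN v : v \in N -> X v \in N by move=> vN; rewrite (subvP XN) ?memv_img.
have inYN v : v \in N -> Y v \in N by move=> vN; rewrite (subvP YN) ?memv_img.
(* On the homology Z / B of Y on N / X N, the relation Y (T v) = X v defines an
   endomorphism T; an eigenvector of T with eigenvalue c gives a class on which
   exactness of X - c Y fails. *)
pose Z := (N :&: Y @^-1: (X @: N))%VS; pose B := (X @: N + Y @: N)%VS.
have ZP v : reflect (v \in N /\ exists2 w, w \in N & Y v = X w) (v \in Z).
  rewrite memv_cap -memv_preim; apply: (iffP andP) => [[vN /memv_imgP[w wN ->]]|].
    by split=> //; exists w.
  by case=> vN [w wN ->]; rewrite memv_img.
have BP v : reflect (exists a b, [/\ a \in N, b \in N & v = X a + Y b]) (v \in B).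
  apply: (iffP memv_addP) => [[_ /memv_imgP[a aN ->]] [_ /memv_imgP[b bN ->] ->]|].
    by exists a, b.
  by case=> a [b [aN bN ->]]; exists (X a); [|exists (Y b)]; rewrite ?memv_img.
pose YN' := (Y \o projv N)%VF.
(* For an element of Y N, [g] chooses a preimage that lies in [N]. *)
pose g := (projv N \o YN'^-1)%VF.
have gN w : g w \in N by rewrite comp_lfunE memv_proj.
have gY w : w \in N -> Y (g (Y w)) = Y w.
  move=> wN; have /limg_lfunVK : Y w \in limg YN'.
    by apply/limgP; exists w; rewrite comp_lfunE projv_id.
  by rewrite /YN' comp_lfunE -[projv N _]comp_lfunE.
pose T := (g \o X)%VF.
have YT v : v \in Z -> Y (T v) = X v.
  case/ZP=> vN [w wN Yv]; rewrite comp_lfunE.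
  have [||u uN ->] := exY (X v); rewrite ?inXN ?gY //.
  by apply: oppr_inj; rewrite -XY Yv XX oppr0.
have TZ : (T @: Z <= Z)%VS.
  apply/subvP=> _ /memv_imgP[v vZ ->]; apply/ZP; split; first by rewrite comp_lfunE.
  by rewrite YT //; exists v => //; case/ZP: vZ.
have BZ v : v \in B -> v \in Z.
  case/BP=> a [b [aN bN ->]]; apply/ZP; split; first by rewrite memvD ?inXN ?inYN.
  exists (- Y a); first by rewrite memvN inYN.
  by rewrite linearD /= YY addr0 linearN /= XY opprK.
have TB : (T @: B <= B)%VS.
  apply/subvP=> _ /memv_imgP[v vB ->]; have := YT _ (BZ _ vB).
  have TN : T v \in N by rewrite comp_lfunE.
  move: (T v) TN => t TN; case/BP: vB => a [b [aN bN ->]].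
  rewrite linearD /= XX add0r XY => Yt.
  have [||c cN tc] := exY (t + X b); first by rewrite memvD ?inXN.
    by rewrite linearD /= Yt addNr.
  apply/BP; exists (- b), c; split; rewrite ?memvN //.
  by rewrite -tc linearN addrCA addNr addr0.
have ZB : (Z <= B)%VS.
  apply: contraT => /(exists_eigenvector_mod TZ TB)[c [v [vZ /BP[a [b [aN bN Tv]]]]]].
  case/negP; have vN : v \in N by case/ZP: vZ.
  have Tv' : X v = c *: Y v + Y (X a).
    rewrite -YT //; have -> : T v = c *: v + (X a + Y b) by rewrite -Tv addrC subrK.
    by rewrite !linearD linearZ /= YY addr0.
  (* Adding Y a changes [v] only inside [B] and makes it a genuine element of the kernel of X - c
     Y. *)
  have [|||w wN vE] := exN 1 (- c) _ (v + Y a); rewrite ?oner_eq0 ?memvD ?inYN //.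
    rewrite scale1r !linearD /= YY XY Tv' scaler0 addr0 scaleNr.
    by rewrite addrK subrr.
  apply/BP; exists w, (- c *: w - a); split; rewrite ?memvB ?memvZ //.
  by rewrite linearB linearZ /= addrA -[LHS](addrK (Y a)) vE scale1r.
move=> v vN YXv; have /(subvP ZB) : v \in Z.
  apply/ZP; split=> //.
  have [||w wN ->] := exX (Y v); rewrite ?inYN ?XY ?YXv ?oppr0 //.
  by exists w.
case/BP=> a [b [aN bN ->]]; exists (- b); rewrite ?memvN //.
by rewrite linearD /= XX add0r XY !linearN.
Qed.

End Pencil.

(** * Products of odd elements acting on a representation *)

Section Words.
Variables (K : numFieldType) (g : lieSuperalgebra K).
Local Notation g0 := (ls_part g false).
Local Notation g1 := (ls_part g true).

(** No grading on [V] is imposed, so that modules and spaces of homomorphisms are treated alike. *)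
Definition bracket_rep (V : vectType K) (rho : 'Hom(g, 'End(V))) : Prop :=
  forall a b x y v, x \in ls_part g a -> y \in ls_part g b ->
    rho (ls_br g x y) v = rho x (rho y v) - (-1) ^+ (a && b) *: rho y (rho x v).

Definition odd_abelian (A : {vspace g}) : Prop :=
  (A <= g1)%VS /\ forall x y, x \in A -> y \in A -> ls_br g x y = 0.

Definition even_normalized (A : {vspace g}) : Prop :=
  forall z x, z \in g0 -> x \in A -> ls_br g z x \in A.

Definition word (V : vectType K) (rho : 'Hom(g, 'End(V))) (s : seq g) : 'End(V) :=
  foldr (fun x f => (rho x \o f)%VF) \1%VF s.

(** For [s] free with span stable under ad z, this is the trace of ad z on the span, that is, the
    character of [z] on its top exterior power. *)
Definition ad_trace (s : seq g) (z : g) : K :=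
  \sum_(i < size s) coord (in_tuple s) i (ls_br g z s`_i).

Section Rep.
Variables (V : vectType K) (rho : 'Hom(g, 'End(V))).
Hypothesis rhoP : bracket_rep rho.
Local Notation word := (word rho).

Lemma word_nil v : word [::] v = v.
Proof. by rewrite id_lfunE. Qed.

Lemma word_cons x s v : word (x :: s) v = rho x (word s v).
Proof. by rewrite comp_lfunE. Qed.

Lemma word_cat s t v : word (s ++ t) v = word s (word t v).
Proof. by elim: s => [|x s IHs]; rewrite ?word_nil //= !comp_lfunE IHs. Qed.

Lemma rep_odd x y v : x \in g1 -> y \in g1 ->
  rho (ls_br g x y) v = rho x (rho y v) + rho y (rho x v).
Proof. by move=> x1 y1; rewrite (rhoP _ x1 y1) expr1 scaleN1r opprK. Qed.

Lemma rep_even z y a v : z \in g0 -> y \in ls_part g a ->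
  rho (ls_br g z y) v = rho z (rho y v) - rho y (rho z v).
Proof. by move=> z0 ya; rewrite (rhoP _ z0 ya) expr0 scale1r. Qed.

Lemma rep_even_comm z y a v : z \in g0 -> y \in ls_part g a ->
  rho z (rho y v) = rho y (rho z v) + rho (ls_br g z y) v.
Proof. by move=> z0 ya; rewrite (rep_even _ z0 ya) addrC subrK. Qed.

Section Abelian.
Variable A : {vspace g}.
Hypothesis AP : odd_abelian A.

Lemma rep_anticomm x y v : x \in A -> y \in A -> rho x (rho y v) = - rho y (rho x v).
Proof.
case: AP => /subvP A1 AA xA yA; apply/eqP; rewrite -addr_eq0.
by rewrite -rep_odd ?A1 // AA // linear0 lfunE.
Qed.

Lemma rep_sqr0 x v : x \in A -> rho x (rho x v) = 0.
Proof.
move=> xA; have /eqP := rep_anticomm v xA xA; rewrite -addr_eq0 -mulr2n.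
by rewrite -scaler_nat scaler_eq0 pnatr_eq0 => /eqP.
Qed.

Lemma word_anticomm s x v : {subset s <= A} -> x \in A ->
  word s (rho x v) = (-1) ^+ size s *: rho x (word s v).
Proof.
move=> sA xA; elim: s sA => [|y s IHs] sA; first by rewrite !word_nil scale1r.
rewrite !word_cons IHs => [|u us]; last by rewrite sA // inE us orbT.
by rewrite linearZ /= rep_anticomm ?(sA y) ?mem_head // exprS mulN1r scaleNr scalerN.
Qed.

Lemma word_dupl s x v : {subset s <= A} -> x \in s -> rho x (word s v) = 0.
Proof.
move=> sA xs; have xA := sA x xs; elim: s sA xs => // y s IHs sA.
have sA' : {subset s <= A} by move=> u us; rewrite sA // inE us orbT.
rewrite inE word_cons => /predU1P[<-|xs]; first exact: rep_sqr0.
by rewrite rep_anticomm ?(sA y) ?mem_head // IHs // linear0 oppr0.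
Qed.

Lemma word_dupr s x v : {subset s <= A} -> x \in s -> word s (rho x v) = 0.
Proof. by move=> sA xs; rewrite word_anticomm ?word_dupl ?scaler0 ?sA. Qed.

Lemma word_killed s x v : {subset s <= A} -> x \in <<s>>%VS -> rho x (word s v) = 0.
Proof.
move=> sA /(@coord_span _ _ _ (in_tuple s)) ->.
rewrite linear_sum sum_lfunE big1 // => i _ /=.
by rewrite linearZ scale_lfunE /= word_dupl ?scaler0 ?mem_nth.
Qed.

End Abelian.

(** Leibniz rule: [z] is moved to the right through the word, each letter being replaced in turn by
    its bracket with [z]. Expanding the bracket over [s], every off-diagonal term repeats a letter
    and vanishes, so only the diagonal coefficients remain. *)
Lemma word_ad_trace s z v : odd_abelian <<s>> -> even_normalized <<s>> ->
  z \in g0 -> rho z (word s v) = word s (rho z v) + ad_trace s z *: word s v.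
Proof.
move=> AP An z0; have sA : {subset s <= <<s>>%VS} by move=> x; exact: memv_span.
(* Here [z] has passed the letters of [s1]; the sum runs over the letters of [s2], which it still
   has to pass. *)
suff aux s2 s1 : s = s1 ++ s2 -> word s1 (rho z (word s2 v)) = word s (rho z v)
    + (\sum_(i < size s | (size s1 <= i)%N) coord (in_tuple s) i (ls_br g z s`_i))
      *: word s v.
  by have := aux s [::] erefl; rewrite word_nil => ->.
elim: s2 s1 => [|x s2 IHs] s1 sE.
  rewrite cats0 in sE; rewrite word_nil big_pred0 ?scale0r ?addr0 -?sE //.
  by move=> i; apply/negbTE; rewrite -ltnNge.
have s1s : (size s1 < size s)%N by rewrite sE size_cat /= addnS ltnS leq_addr.
have xs : x \in s by rewrite sE mem_cat mem_head orbT.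
have x1 : x \in g1 by case: AP => /subvP/(_ x)-> //; exact: sA.
rewrite word_cons (rep_even_comm _ z0 x1) linearD /=.
have := IHs (rcons s1 x); rewrite cat_rcons => /(_ sE).
rewrite -cats1 word_cat word_cons word_nil => ->; rewrite -addrA; congr (_ + _).
have xE : s`_(size s1) = x by rewrite sE nth_cat ltnn subnn.
pose i0 := Ordinal s1s.
rewrite [X in _ = X *: _](bigD1 i0) //= scalerDl addrC; congr (_ + _); last first.
  congr (_ *: _); apply: eq_bigl => i.
  by rewrite size_cat addn1 ltn_neqAle andbC -val_eqE /= [(i : nat) == _]eq_sym.
have -> : ls_br g z s`_(size s1) = ls_br g z x by rewrite -[in RHS]xE.
rewrite [in LHS](@coord_span _ _ _ (in_tuple s) (ls_br g z x)); last first.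
  by rewrite An // sA.
rewrite linear_sum sum_lfunE linear_sum (bigD1 i0) //= big1 ?addr0 => [|i i0i].
  by rewrite linearZ scale_lfunE linearZ /= xE; congr (_ *: _); rewrite sE word_cat word_cons.
rewrite linearZ scale_lfunE linearZ /=.
have nthE t : t = s1 ++ x :: s2 -> (i < size t)%N -> (t`_i \in s1) || (t`_i \in s2).
  move=> ->; rewrite nth_cat size_cat /= => iS.
  case: ltnP => [i1|i1]; first by rewrite mem_nth.
  have i2 : (0 < i - size s1)%N.
    by rewrite subn_gt0 ltn_neqAle i1 andbT eq_sym -[size s1]/(val i0) val_eqE i0i.
  by rewrite -(prednK i2) /= mem_nth ?orbT // -ltnS prednK // ltn_subLR // addnC.
have /orP[is1|is2] := nthE s sE (ltn_ord i).
- rewrite (word_dupr AP) ?scaler0 // => u us.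
  by rewrite sA // sE mem_cat us.
- rewrite (word_dupl AP) ?linear0 ?scaler0 // => u us.
  by rewrite sA // sE mem_cat inE us !orbT.
Qed.

End Rep.
End Words.

Section Exactness.
Variables (K : numClosedFieldType) (g : lieSuperalgebra K).
Variables (V : vectType K) (rho : 'Hom(g, 'End(V))) (A : {vspace g}).
Hypotheses (rhoP : bracket_rep rho) (AP : odd_abelian A).
Hypothesis exA : forall x v, x \in A -> x != 0 -> rho x v = 0 ->
  exists w, v = rho x w.
Local Notation word := (word rho).

(** Induction on [l] for all [x] at once: for l = y :: l', every nonzero combination of [x] and [y]
    is exact on the image of the word in l', and [exact_pencil] yields exactness of [x] on the image
    of the word in y :: l'. *)
Lemma word_exact l x v : {subset x :: l <= A} -> free (x :: l) ->
  rho x (word l v) = 0 -> exists w, word l v = rho x (word l w).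
Proof.
elim: l x v => [|y l IHl] x v lA.
  rewrite seq1_free word_nil => x0 /exA[|//|w ->]; first by rewrite lA ?mem_head.
  by exists w; rewrite word_nil.
have xA : x \in A by rewrite lA ?mem_head.
have yA : y \in A by rewrite lA // !inE eqxx orbT.
have {}lA : {subset l <= A} by move=> z zl; rewrite lA // !inE zl !orbT.
rewrite free_cons span_cons => /andP[xyl fyl]; rewrite !word_cons => xylv.
have stab z : z \in A -> (rho z @: limg (word l) <= limg (word l))%VS.
  move=> zA; apply/subvP => _ /memv_imgP[_ /limgP[w ->] ->].
  apply/limgP; exists ((-1) ^+ size l *: rho z w).
  by rewrite linearZ /= (word_anticomm rhoP AP) // signrZK.
have yl : y \notin <<l>>%VS by move: fyl; rewrite free_cons => /andP[].
have fl : free l by move: fyl; rewrite free_cons => /andP[].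
have [||||||||_ /limgP[w ->] wE] := @exact_pencil K V (rho y) (rho x) (limg (word l))
    _ _ _ _ _ _ (word l v); rewrite ?stab //.
- by move=> w; rewrite (rep_sqr0 rhoP AP).
- by move=> w; rewrite (rep_sqr0 rhoP AP).
- by move=> w; rewrite (rep_anticomm rhoP AP w yA xA).
- move=> a b ab _ /limgP[w ->].
  have lin u : a *: rho y u + b *: rho x u = rho (a *: y + b *: x) u.
    by rewrite linearD !linearZ add_lfunE !scale_lfunE.
  rewrite lin => /IHl[||w' ->].
  + move=> z; rewrite inE => /predU1P[->|/lA//].
    by rewrite memvD ?memvZ.
  + rewrite free_cons fl andbT; apply: contra xyl => abl.
    have [b0|b0] := eqVneq b 0.
      move: ab abl; rewrite b0 scale0r addr0 eqxx orbF => a0 /(memvZ a^-1).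
      by rewrite scalerA mulVf // scale1r (negPf yl).
    have -> : x = b^-1 *: (a *: y + b *: x) - (b^-1 * a) *: y.
      by rewrite scalerDr !scalerA mulVf // scale1r addrC addKr.
    apply: memvB; apply: memvZ; first exact: (subvP (addvSr _ _)).
    exact: (subvP (addvSl _ _)) (memv_line _).
  + by exists (word l w'); rewrite ?lin //; apply/limgP; exists w'.
- by apply/limgP; exists v.
- by exists w; rewrite word_cons.
Qed.

Lemma killed_in_word l v : {subset l <= A} -> free l ->
  (forall x, x \in l -> rho x v = 0) -> exists w, v = word l w.
Proof.
elim: l => [|x l IHl] lA fl lv; first by exists v; rewrite word_nil.
have [||y yl|w vE] := IHl.
- by move=> y yl; rewrite lA // inE yl orbT.
- by move: fl; rewrite free_cons => /andP[].
- by rewrite lv // inE yl orbT.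
have [|w' w'E] := word_exact lA fl (v := w); first by rewrite -vE lv ?mem_head.
by exists w'; rewrite word_cons -w'E.
Qed.

(** By [word_exact], subtracting a suitable element of the image of the first letter from [v] leaves
    a vector killed by the shorter word. *)
Lemma word_kernel l v : {subset l <= A} -> free l ->
  word l v = 0 -> v \in (\sum_(x <- l) limg (rho x))%VS.
Proof.
elim: l v => [|x l IHl] v lA fl; first by rewrite word_nil => ->; rewrite mem0v.
rewrite word_cons => /(word_exact lA fl)[w wE].
have xA : x \in A by rewrite lA ?mem_head.
have lA' : {subset l <= A} by move=> y yl; rewrite lA // inE yl orbT.
rewrite big_cons -[v](subrK ((-1) ^+ size l *: rho x w)) addrC memv_add //.
  by rewrite memvZ //; apply/limgP; exists w.
apply: IHl => //; first by move: fl; rewrite free_cons => /andP[].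
by rewrite linearB linearZ /= (word_anticomm rhoP AP) // signrZK wE subrr.
Qed.

End Exactness.

(** * Invariance of top products *)

Section Trace.
Variables (K : numFieldType) (g : lieSuperalgebra K).
Local Notation g0 := (ls_part g false).
Local Notation g1 := (ls_part g true).
Variables (V : vectType K) (rho : 'Hom(g, 'End(V))) (ys : seq g) (u : V).
Hypotheses (rhoP : bracket_rep rho) (AP : odd_abelian <<ys>>)
  (An : even_normalized <<ys>>).
Hypothesis u_char : forall z, z \in g0 -> rho z u = - ad_trace ys z *: u.
Local Notation word := (word rho).

(** The span of the products of sublists of [l] applied to [u]: an image of the exterior algebra on
    [l]. *)
Fixpoint exterior_orbit (l : seq g) : {vspace V} :=
  if l is y :: l' then (exterior_orbit l' + rho y @: exterior_orbit l')%VS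
  else <[u]>%VS.
Local Notation E := exterior_orbit.

Let sA : {subset ys <= <<ys>>%VS}. Proof. by move=> y; exact: memv_span. Qed.

Lemma exterior_orbit_consP y l w :
  reflect (exists a b, [/\ a \in E l, b \in E l & w = a + rho y b]) (w \in E (y :: l)).
Proof.
apply: (iffP memv_addP) => [[a aE [_ /memv_imgP[b bE ->] ->]]|[a [b [aE bE ->]]]].
  by exists a, b.
by exists a => //; exists (rho y b); rewrite ?memv_img.
Qed.

(** The character of [u] is opposite to the one contributed by the word, so the two cancel. *)
Lemma word_even0 z : z \in g0 -> rho z (word ys u) = 0.
Proof.
move=> z0; rewrite (word_ad_trace rhoP) // u_char // linearZ /= scaleNr.
by rewrite addNr.
Qed.

Lemma exterior_orbit_mul l y w :
  {subset l <= ys} -> y \in l -> w \in E l -> rho y w \in E l.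
Proof.
elim: l w => // y' l IHl w lys; have y'ys := lys y' (mem_head _ _).
have {}lys : {subset l <= ys} by move=> x xl; rewrite lys // inE xl orbT.
rewrite inE => /predU1P yl /exterior_orbit_consP[a [b [aE bE ->]]].
apply/exterior_orbit_consP; case: yl => [->|yl].
  exists 0, a; split; rewrite ?mem0v //.
  by rewrite linearD /= (rep_sqr0 rhoP AP) ?sA // addr0 add0r.
exists (rho y a), (- rho y b); split; rewrite ?memvN ?IHl //.
by rewrite linearD linearN /= (rep_anticomm rhoP AP b (sA (lys y yl)) (sA y'ys)).
Qed.

Lemma exterior_orbit_mul_span y w :
  y \in <<ys>>%VS -> w \in E ys -> rho y w \in E ys.
Proof.
move=> /(@coord_span _ _ _ (in_tuple ys)) -> wE.
rewrite linear_sum sum_lfunE memv_suml // => i _.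
by rewrite linearZ scale_lfunE memvZ // exterior_orbit_mul // mem_nth.
Qed.

Lemma exterior_orbit_base l : u \in E l.
Proof.
elim: l => [|y l IHl]; first exact: memv_line.
by apply/exterior_orbit_consP; exists u, 0; split; rewrite ?mem0v ?linear0 ?addr0.
Qed.

Lemma exterior_orbit_sub l w :
  {subset l <= ys} -> w \in E l -> w \in E ys.
Proof.
elim: l w => [|y l IHl] w lys.
  by move=> /vlineP[k ->]; rewrite memvZ // exterior_orbit_base.
have yys := lys y (mem_head _ _).
have {}lys : {subset l <= ys} by move=> x xl; rewrite lys // inE xl orbT.
move=> /exterior_orbit_consP[a [b [aE bE ->]]].
rewrite memvD ?(IHl _ lys aE) //.
exact: (exterior_orbit_mul (fun _ => id) yys (IHl _ lys bE)).
Qed.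

Lemma exterior_orbit_even z w : z \in g0 -> w \in E ys -> rho z w \in E ys.
Proof.
move=> z0; suff aux l : {subset l <= ys} -> forall v, v \in E l -> rho z v \in E ys.
  exact: aux.
elim: l => [|y l IHl] lys v.
  move=> /vlineP[k ->]; rewrite linearZ /= u_char // memvZ // memvZ //.
  exact: exterior_orbit_base.
have yys := lys y (mem_head _ _).
have {}lys : {subset l <= ys} by move=> x xl; rewrite lys // inE xl orbT.
move=> /exterior_orbit_consP[a [b [aE bE ->]]].
have y1 : y \in g1 by case: AP => /subvP/(_ y)-> //; exact: sA.
rewrite linearD /= (rep_even_comm rhoP _ z0 y1) memvD ?(IHl lys _ aE) // memvD //.
  by apply: exterior_orbit_mul (fun _ => id) yys (IHl lys _ bE).
apply: exterior_orbit_mul_span; first exact: An (sA yys).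
exact: exterior_orbit_sub bE.
Qed.

(** Moving [x] past a letter [y] costs the bracket [x, y], which lies in g0 and so preserves the
    orbit. *)
Lemma exterior_orbit_odd x w : x \in g1 -> rho x u = 0 ->
  w \in E ys -> rho x w \in E ys.
Proof.
move=> x1 xu; suff aux l : {subset l <= ys} -> forall v, v \in E l -> rho x v \in E ys.
  exact: aux.
elim: l => [|y l IHl] lys v.
  by move=> /vlineP[k ->]; rewrite linearZ /= xu scaler0 mem0v.
have yys := lys y (mem_head _ _).
have {}lys : {subset l <= ys} by move=> t tl; rewrite lys // inE tl orbT.
move=> /exterior_orbit_consP[a [b [aE bE ->]]].
have y1 : y \in g1 by case: AP => /subvP/(_ y)-> //; exact: sA.
have -> : rho x (a + rho y b) = rho x a + (rho (ls_br g x y) b - rho y (rho x b)).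
  by rewrite linearD /= (rep_odd rhoP _ x1 y1) addrK.
rewrite memvD ?(IHl lys _ aE) // memvB //.
  apply: exterior_orbit_even; first exact: (ls_br_part x1 y1).
  exact: exterior_orbit_sub bE.
by apply: exterior_orbit_mul (fun _ => id) yys (IHl lys _ bE).
Qed.

(* When the top product does not vanish, the orbit is the exterior algebra and
   every nonzero element can be multiplied up into its top degree. *)
Lemma exterior_orbit_socle l w : {subset l <= ys} -> word l u != 0 ->
  w \in E l -> w != 0 ->
  exists t c, [/\ {subset t <= l}, c != 0 & word t w = c *: word l u].
Proof.
elim: l w => [|y l IHl] w lys.
  rewrite word_nil => u0 /vlineP[k ->] ku; exists [::], k; split=> //.
    by apply: contraNneq ku => ->; rewrite scale0r.
  by rewrite word_nil.
have yA : y \in <<ys>>%VS by rewrite sA // lys // mem_head.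
have {}lys : {subset l <= ys} by move=> x xl; rewrite lys // inE xl orbT.
have lA : {subset l <= <<ys>>%VS} by move=> x /lys/sA.
rewrite word_cons => yl0 /exterior_orbit_consP[a [b [aE bE ->]]] w0.
have l0 : word l u != 0 by apply: contraNneq yl0 => ->; rewrite linear0.
have [a0|a0] := eqVneq a 0.
  have b0 : b != 0 by apply: contraNneq w0 => ->; rewrite a0 linear0 addr0.
  have [t [c [tl c0 tb]]] := IHl b lys l0 bE b0.
  exists t, ((-1) ^+ size t * c); split.
  - by move=> x /tl xl; rewrite inE xl orbT.
  - by rewrite mulf_neq0 // signr_eq0.
  - rewrite a0 add0r (word_anticomm rhoP AP) ?tb //; last by move=> x /tl/lA.
    by rewrite linearZ /= scalerA.
have [t [c [tl c0 ta]]] := IHl a lys l0 aE a0.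
exists (y :: t), c; split=> //.
  by move=> x; rewrite !inE => /predU1P[->|/tl->]; rewrite ?eqxx ?orbT.
have tA : {subset t <= <<ys>>%VS} by move=> x /tl/lA.
rewrite word_cons linearD /= (word_anticomm rhoP AP _ tA yA) linearD linearZ /=.
by rewrite (rep_sqr0 rhoP AP) // scaler0 addr0 ta linearZ.
Qed.

(** Suppose x w is nonzero, where w is the top product applied to [u]. It lies in the orbit and is
    killed by every letter, because [x, y] in g0 kills w; hence it is a multiple of w. Now [h] kills
    w, and therefore also x w, while the bracket relation makes [h] act on x w by [a], which is
    nonzero. *)
Lemma word_odd0 h a x : h \in g0 -> x \in g1 -> ls_br g h x = a *: x -> a != 0 ->
  rho x u = 0 -> rho x (word ys u) = 0.
Proof.
move=> h0 x1 hx a0 xu; have [ys0|ys0] := eqVneq (word ys u) 0; first by rewrite ys0 linear0.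
apply/eqP; apply: contraT => w0.
have y1 y : y \in ys -> y \in g1 by case: AP => /subvP A1 _ /sA/A1.
have yw y : y \in ys -> rho y (rho x (word ys u)) = 0.
  move=> yys; apply/eqP; have := rep_odd rhoP (word ys u) x1 (y1 y yys).
  rewrite (word_dupl rhoP AP _ sA yys) linear0 add0r => <-.
  by rewrite word_even0 //; exact: (ls_br_part x1 (y1 y yys)).
have wE : rho x (word ys u) \in E ys.
  apply: exterior_orbit_odd => //.
  have : {subset ys <= ys} by [].
  elim: {1 3}ys => [|y l IHl] lys; first by rewrite word_nil exterior_orbit_base.
  rewrite word_cons exterior_orbit_mul ?lys ?mem_head // IHl // => z zl.
  by rewrite lys // inE zl orbT.
have [t [c [tys c0 tw]]] := exterior_orbit_socle (fun _ => id) ys0 wE w0.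
have {tw} tw : rho x (word ys u) = c *: word ys u.
  have ys_neq0 : c *: word ys u != 0 by rewrite scaler_eq0 negb_or c0.
  (* A nonempty [t] is impossible: its first letter can be carried to the right, where it kills the
     vector. *)
  case: t tys tw => [|y t] tys; first by rewrite word_nil.
  have yys := tys y (mem_head _ _).
  have -> : word (y :: t) (rho x (word ys u)) = 0.
    have {}tys : {subset rcons t y <= ys}.
      by move=> z; rewrite mem_rcons => /tys.
    have tA : {subset t <= <<ys>>%VS}.
      by move=> z zt; rewrite sA // tys // mem_rcons inE zt orbT.
    rewrite word_cons; apply: (can_inj (@signrZK _ _ (odd (size t)))).
    by rewrite scaler0 signr_odd -(word_anticomm rhoP AP) ?yw ?linear0 ?sA.
  by move/esym/eqP; rewrite (negPf ys_neq0).
have := rep_even rhoP (word ys u) h0 x1.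
rewrite hx linearZ scale_lfunE /= (word_even0 h0) linear0 subr0 tw linearZ /=.
rewrite [rho h _]linearZ /= (word_even0 h0) scaler0 => /eqP.
by rewrite !scaler_eq0 (negPf a0) (negPf c0) (negPf ys0).
Qed.

End Trace.

(** * Semisimplicity over the even part *)

Lemma daddv_piD (F : fieldType) (V : vectType F) (U W : {vspace V}) u w :
  (U :&: W = 0)%VS -> u \in U -> w \in W -> daddv_pi U W (u + w) = u.
Proof.
move=> UW uU wW; rewrite linearD /= daddv_pi_id //.
have := @daddv_pi_add _ _ U W w UW; rewrite (subvP (addvSr U W)) // => /(_ isT).
by rewrite [daddv_pi W U w]daddv_pi_id 1?capvC // => /(canRL (addrK _)) ->;
  rewrite subrr addr0.
Qed.

Section Semisimple.
Variables (K : numFieldType) (g : lieSuperalgebra K).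
Local Notation g0 := (ls_part g false).

Lemma even_stableP (V : vectType K) (rho : 'Hom(g, 'End(V))) (W : {vspace V}) :
  even_stable rho W <-> forall z v, z \in g0 -> v \in W -> rho z v \in W.
Proof.
split=> WP z; first by move=> v z0 vW; rewrite (subvP (WP z z0)) // memv_img.
by move=> z0; apply/subvP => _ /memv_imgP[v vW ->]; apply: WP.
Qed.

(** The simple summands are examined one at a time: each either lies in W + U already or meets it in
    0 and can be added to [U]. *)
Lemma even_stable_complement (V : vectType K) (rho : 'Hom(g, 'End(V))) W :
  even_semisimple rho fullv -> even_stable rho W ->
  exists U, [/\ even_stable rho U, (W :&: U = 0)%VS & (W + U = fullv)%VS].
Proof.
case=> n [S [simS _ sumS]] stW.
suff aux k : exists U, [/\ even_stable rho U, (W :&: U = 0)%VS &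
    forall i : 'I_n, (i < k)%N -> (S i <= W + U)%VS].
  have [U [stU WU SU]] := aux n; exists U; split=> //.
  by apply/eqP; rewrite eqEsubv subvf -sumS; apply/subv_sumP => i _; apply: SU.
elim: k => [|k [U [stU WU SU]]].
  by exists 0%VS; split; rewrite ?capv0 // => z _; rewrite limg0 subvv.
have [kn|nk] := ltnP k n; last first.
  by exists U; split=> // i _; apply: SU; rewrite (leq_trans _ nk).
have [_ stS minS] := simS (Ordinal kn).
have SP i : (i < k.+1)%N -> (i < k)%N \/ i = k.
  by rewrite ltnS leq_eqVlt => /predU1P[]; [right|left].
have stWU : even_stable rho (W + U)%VS.
  by move=> z z0; rewrite limgD addvS ?stW ?stU.
have [||cap0|capS] := minS (S (Ordinal kn) :&: (W + U))%VS; rewrite ?capvSl //.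
- move=> z z0; apply: subv_trans (limg_cap _ _ _) _.
  by rewrite capvS ?stS ?stWU.
- exists (U + S (Ordinal kn))%VS; split.
  + by move=> z z0; rewrite limgD addvS ?stS ?stU.
  + apply/eqP; rewrite -subv0; apply/subvP => v; rewrite memv_cap.
    case/andP=> vW /memv_addP[u uU [s sS vE]].
    have : s \in (S (Ordinal kn) :&: (W + U))%VS.
      rewrite memv_cap sS (_ : s = v + - u) ?memv_add ?memvN //.
      by rewrite vE addrC addKr.
    rewrite cap0 memv0 => /eqP s0; rewrite -WU memv_cap vW.
    by rewrite vE s0 addr0.
  + move=> i /SP[/SU SWU|ik].
      by apply: subv_trans SWU _; rewrite addvS ?addvSl.
    have -> : i = Ordinal kn by apply: val_inj.
    by rewrite addvA addvSr.
- exists U; split=> // i /SP[/SU //|ik].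
  have -> : i = Ordinal kn by apply: val_inj.
  by rewrite -capS capvSr.
Qed.

(** Kernel and image of [T] are g0-stable, hence have stable complements [C] and [D]. [S] inverts
    [T] from its image back to [C] and vanishes on [D], so its twist is opposite to that of [T].
    This serves both for lifting morphisms and for inverting top products. *)
Lemma even_pseudo_inverse (V W : vectType K) (rho : 'Hom(g, 'End(V)))
    (sig : 'Hom(g, 'End(W))) (T : 'Hom(V, W)) (chi : g -> K) :
  even_semisimple rho fullv -> even_semisimple sig fullv ->
  (forall z v, z \in g0 -> sig z (T v) = T (rho z v) + chi z *: T v) ->
  exists S : 'Hom(W, V), (forall v, T (S (T v)) = T v) /\
    forall z w, z \in g0 -> rho z (S w) = S (sig z w) - chi z *: S w.
Proof.
move=> ssV ssW TP.
have [|C [stC kC sumC]] := @even_stable_complement V rho (lker T) ssV.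
  apply/even_stableP => z v z0; rewrite !memv_ker => /eqP Tv.
  by have := TP z v z0; rewrite Tv linear0 scaler0 addr0 => <-.
have [|D [stD kD sumD]] := @even_stable_complement W sig (limg T) ssW.
  apply/even_stableP => z w z0 /limgP[v ->]; apply/limgP.
  by exists (rho z v + chi z *: v); rewrite TP // linearD linearZ.
pose S := (daddv_pi C (lker T) \o T^-1 \o daddv_pi (limg T) D)%VF.
have SE c d : c \in C -> d \in D -> S (T c + d) = c.
  move=> cC dD; rewrite !comp_lfunE daddv_piD ?memv_img ?memvf //.
  have -> : (T^-1)%VF (T c) = c + ((T^-1)%VF (T c) - c) by rewrite addrC subrK.
  rewrite daddv_piD 1?capvC // memv_ker linearB /= limg_lfunVK ?subrr //.
  by apply/limgP; exists c.
have VE v : exists c, c \in C /\ T v = T c.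
  have : v \in (lker T + C)%VS by rewrite sumC memvf.
  case/memv_addP => k kT [c cC ->]; exists c; split=> //.
  by move: kT; rewrite memv_ker linearD /= => /eqP->; rewrite add0r.
exists S; split=> [v|z w z0].
  by have [c [cC ->]] := VE v; rewrite -[X in S X]addr0 SE ?mem0v.
have : w \in (limg T + D)%VS by rewrite sumD memvf.
case/memv_addP => _ /limgP[v ->] [d dD ->]; have [c [cC ->]] := VE v.
have stC' := (even_stableP _ _).1 stC z c z0 cC.
have stD' := (even_stableP _ _).1 stD z d z0 dD.
rewrite SE // linearD /= TP // -linearZ -linearD /= SE ?memvD ?memvZ //.
by rewrite addrK.
Qed.

End Semisimple.

(** * The action on homomorphisms *)

Section Parity.
Variables (K : numFieldType) (V : vectType K) (P : bool -> {vspace V}).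
Hypotheses (capP : (P false :&: P true = 0)%VS)
  (sumP : (P false + P true = fullv)%VS).

Definition parity : 'End(V) :=
  locked (daddv_pi (P false) (P true) - daddv_pi (P true) (P false)).

Lemma homogeneous_decomposition v :
  exists v0 v1, [/\ v0 \in P false, v1 \in P true & v = v0 + v1].
Proof.
have : v \in (P false + P true)%VS by rewrite sumP memvf.
by case/memv_addP => v0 v0P [v1 v1P ->]; exists v0, v1.
Qed.

Lemma parityE a v : v \in P a -> parity v = (-1) ^+ a *: v.
Proof.
have capP' : (P true :&: P false = 0)%VS by rewrite capvC.
rewrite /parity -lock add_lfunE opp_lfunE; case: a => va.
  rewrite -[in X in X - _](add0r v) daddv_piD ?mem0v // daddv_pi_id //.
  by rewrite scaleN1r sub0r.
rewrite -[in X in _ - X](add0r v) daddv_piD ?mem0v // daddv_pi_id //.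
by rewrite scale1r subr0.
Qed.

Lemma parityK v : parity (parity v) = v.
Proof.
have [v0 [v1 [v0P v1P ->]]] := homogeneous_decomposition v.
by rewrite linearD /= (parityE v0P) (parityE v1P) !linearD !linearZ /=
  (parityE v0P) (parityE v1P) !scalerA -!expr2 !sqrr_sign !scale1r.
Qed.

Lemma parity_mem (a : bool) v : parity v = (-1) ^+ a *: v -> v \in P a.
Proof.
have [v0 [v1 [v0P v1P ->]]] := homogeneous_decomposition v.
rewrite linearD /= (parityE v0P) (parityE v1P) expr0 expr1 scaleN1r scale1r.
have eq0 (w : V) : w = - w -> w = 0.
  move/eqP; rewrite -addr_eq0 -mulr2n -scaler_nat scaler_eq0 pnatr_eq0 /=.
  by move/eqP.
case: a => /=.
  by rewrite expr1 scaleN1r opprD => /addIr/eq0->; rewrite add0r.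
by rewrite scale1r => /addrI/esym/eq0 ->; rewrite addr0.
Qed.

End Parity.

Section HomRep.
Variables (K : numFieldType) (g : lieSuperalgebra K).
Local Notation g0 := (ls_part g false).
Local Notation g1 := (ls_part g true).

Definition sgn (M : superModule g) : 'End(M) := parity (sm_part M).

Lemma sgnE (M : superModule g) a v : v \in sm_part M a -> sgn M v = (-1) ^+ a *: v.
Proof. exact: (parityE (sm_part_cap M)). Qed.

Lemma sgnK (M : superModule g) v : sgn M (sgn M v) = v.
Proof. exact: (parityK (sm_part_cap M) (sm_part_sum M)). Qed.

Lemma sgn_act (M : superModule g) a x v : x \in ls_part g a ->
  sgn M (sm_act M x v) = (-1) ^+ a *: sm_act M x (sgn M v).
Proof.
move=> xa.
have [v0 [v1 [v0P v1P ->]]] := homogeneous_decomposition (sm_part_sum M) v.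
rewrite !linearD /= (sgnE v0P) (sgnE v1P).
rewrite (sgnE (sm_act_part xa v0P)) (sgnE (sm_act_part xa v1P)).
rewrite ![sm_act M x (_ *: _)]linearZ /= !scalerA.
by case: a xa => _; rewrite !(expr0, expr1, mulr1, mul1r, mulrNN).
Qed.

Section Pair.
Variables M N : superModule g.

(** On a homogeneous [f] this is multiplication by the sign of its parity; it provides that sign
    when [f] has no fixed parity. *)
Definition sgn_conj (f : 'Hom(M, N)) : 'Hom(M, N) := (sgn N \o f \o sgn M)%VF.

Lemma sgn_conjE f v : sgn_conj f v = sgn N (f (sgn M v)).
Proof. by rewrite !comp_lfunE. Qed.

Lemma sgn_conjK f : sgn_conj (sgn_conj f) = f.
Proof. by apply/lfunP => v; rewrite !sgn_conjE !sgnK. Qed.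

Lemma sgn_conj_linear : linear sgn_conj.
Proof.
move=> k f h; apply/lfunP => v.
by rewrite !(add_lfunE, scale_lfunE) !sgn_conjE !(add_lfunE, scale_lfunE) linearP.
Qed.

HB.instance Definition _ := GRing.isLinear.Build K 'Hom(M, N) 'Hom(M, N) _
  sgn_conj sgn_conj_linear.

Let pi a : 'End(g) := daddv_pi (ls_part g a) (ls_part g (~~ a)).

Let pi_cap a : (ls_part g a :&: ls_part g (~~ a) = 0)%VS.
Proof. by case: a; [rewrite capvC|]; apply: ls_part_cap. Qed.

Let piE a x : x \in ls_part g a -> pi a x = x.
Proof. exact: daddv_pi_id (pi_cap a). Qed.

Let piN a x : x \in ls_part g a -> pi (~~ a) x = 0.
Proof.
move=> xa; rewrite -[x]add0r /pi daddv_piD ?mem0v //; last by rewrite negbK.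
Qed.

(** The usual rule x f - (-1)^(|x||f|) f x, made linear in both arguments by splitting [x] into its
    even and odd components and using [sgn_conj] for the sign. *)
Definition hom_act_fun (x : g) (f : 'Hom(M, N)) : 'Hom(M, N) :=
  locked ((sm_act N x \o f)%VF - (f \o sm_act M (pi false x))%VF
    - (sgn_conj f \o sm_act M (pi true x))%VF).

Lemma hom_act_funE x f v : hom_act_fun x f v =
  sm_act N x (f v) - f (sm_act M (pi false x) v) - sgn_conj f (sm_act M (pi true x) v).
Proof. by rewrite /hom_act_fun -lock !add_lfunE !opp_lfunE !comp_lfunE. Qed.

Lemma hom_act_fun_linear x : linear (hom_act_fun x).
Proof.
move=> k f h; apply/lfunP => v.
rewrite hom_act_funE linearP !add_lfunE !scale_lfunE linearP !hom_act_funE /=.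
by rewrite !opprD !scalerBr [X in X + _ = _]addrACA [LHS]addrACA.
Qed.

HB.instance Definition _ x := GRing.isLinear.Build K 'Hom(M, N) 'Hom(M, N) _
  (hom_act_fun x) (hom_act_fun_linear x).

Definition hom_act (x : g) : 'End('Hom(M, N)) := linfun (hom_act_fun x).

Lemma hom_actE x f v : hom_act x f v =
  sm_act N x (f v) - f (sm_act M (pi false x) v) - sgn_conj f (sm_act M (pi true x) v).
Proof. by rewrite lfunE hom_act_funE. Qed.

Lemma hom_act_linear : linear hom_act.
Proof.
move=> k x y; apply/lfunP => f; apply/lfunP => v.
have lin (W : vectType K) (r : 'Hom(g, 'End(W))) a b w :
    r (k *: a + b) w = k *: r a w + r b w.
  by rewrite linearP add_lfunE scale_lfunE.
rewrite !(add_lfunE, scale_lfunE) !hom_actE ![pi _ (_ + _)]linearP !lin.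
rewrite [f (_ + _)]linearP [sgn_conj f (_ + _)]linearP /=.
by rewrite !opprD !scalerBr [X in X + _ = _]addrACA [LHS]addrACA.
Qed.

HB.instance Definition _ := GRing.isLinear.Build K g 'End('Hom(M, N)) _
  hom_act hom_act_linear.

Definition hom_rep : 'Hom(g, 'End('Hom(M, N))) := linfun hom_act.

Definition sgn_twist a (f : 'Hom(M, N)) := if a then sgn_conj f else f.

Lemma hom_repE a x f v : x \in ls_part g a ->
  hom_rep x f v = sm_act N x (f v) - sgn_twist a f (sm_act M x v).
Proof.
move=> xa; rewrite lfunE hom_actE; case: a xa => xa.
  by rewrite (piE xa) (piN xa) linear0 zero_lfunE linear0 subr0.
by rewrite (piE xa) (piN xa) linear0 zero_lfunE linear0 subr0.
Qed.

Lemma sgn_twistD a b f : sgn_twist a (sgn_twist b f) = sgn_twist (a (+) b) f.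
Proof. by case: a b => [] []; rewrite //= sgn_conjK. Qed.

Lemma sgn_conj_hom_rep a x f : x \in ls_part g a ->
  sgn_conj (hom_rep x f) = (-1) ^+ a *: hom_rep x (sgn_conj f).
Proof.
move=> xa; apply/lfunP => v.
rewrite sgn_conjE scale_lfunE !(hom_repE _ _ xa) linearB /= (sgn_act _ xa) scalerBr.
congr (_ - _); first by rewrite sgn_conjE.
case: a xa => xa; rewrite /= ?sgn_conjK sgn_conjE (sgn_act _ xa) ?sgnK.
  by rewrite expr1 !scaleN1r linearN.
by rewrite expr0 !scale1r.
Qed.

Lemma sgn_twist_hom_rep a b x f : x \in ls_part g a ->
  sgn_twist b (hom_rep x f) = (-1) ^+ (a && b) *: hom_rep x (sgn_twist b f).
Proof.
move=> xa; case: b => /=; last by rewrite andbF scale1r.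
by rewrite andbT (sgn_conj_hom_rep _ xa).
Qed.

Lemma hom_rep_bracket : bracket_rep hom_rep.
Proof.
move=> a b x y f xa yb; apply/lfunP => v.
rewrite (hom_repE _ _ (ls_br_part xa yb)) add_lfunE opp_lfunE scale_lfunE.
rewrite !(hom_repE _ _ xa) !(hom_repE _ _ yb).
rewrite (sgn_twist_hom_rep _ _ xa) (sgn_twist_hom_rep _ _ yb) !scale_lfunE.
rewrite !(hom_repE _ _ xa) !(hom_repE _ _ yb) !sgn_twistD.
rewrite (sm_act_br _ xa yb) (sm_act_br _ xa yb) (andbC b) (addbC b).
rewrite [sgn_twist _ f (_ - _)]linearB /=.
rewrite [sgn_twist _ f (_ *: _)]linearZ /=.
rewrite [sm_act N x (_ - _)]linearB [sm_act N y (_ - _)]linearB /=.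
rewrite !scalerBr !scalerA -signr_addb addbb !scale1r.
rewrite !opprB [RHS]addrACA !subrKA [LHS]addrACA [RHS]addrACA.
by congr (_ + _); rewrite addrC.
Qed.

End Pair.

End HomRep.

(** * Eigenvalues of [h] and the action of words on homomorphisms *)

Section Weights.
Variables (K : numFieldType) (g : lieSuperalgebra K).
Local Notation g0 := (ls_part g false).
Local Notation g1 := (ls_part g true).

Lemma sm_rep (M : superModule g) : bracket_rep (sm_act M).
Proof. by move=> a b x y v; exact: sm_act_br. Qed.

Lemma word_sgn (M : superModule g) (s : seq g) v : {subset s <= g1} ->
  sgn M (word (sm_act M) s v) = (-1) ^+ size s *: word (sm_act M) s (sgn M v).
Proof.
elim: s => [|x s IHs] s1; first by rewrite !word_nil scale1r.
rewrite !word_cons (sgn_act _ (s1 x (mem_head _ _))) IHs => [|y ys].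
  by rewrite linearZ scalerA /= -exprS.
by rewrite s1 // inE ys orbT.
Qed.

Lemma sgn_twist_word (M N : superModule g) (s : seq g) b (f : 'Hom(M, N)) :
  {subset s <= g1} ->
  sgn_twist b (word (hom_rep M N) s f)
    = (-1) ^+ (b * size s) *: word (hom_rep M N) s (sgn_twist b f).
Proof.
elim: s => [|x s IHs] s1; first by rewrite !word_nil muln0 scale1r.
rewrite !word_cons (sgn_twist_hom_rep _ _ (s1 x (mem_head _ _))) IHs => [|y ys].
  by rewrite linearZ scalerA /= -exprD mulnS; case: (b).
by rewrite s1 // inE ys orbT.
Qed.

Variables (h : g) (wt : g -> K).
Hypothesis h0 : h \in g0.

Section Module.
Variables M N : superModule g.
Local Notation hword := (word (hom_rep M N)).
Local Notation mword := (word (sm_act M)).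

Lemma weight_step x a c u : x \in ls_part g a -> ls_br g h x = wt x *: x ->
  sm_act M h u = c *: u -> sm_act M h (sm_act M x u) = (c + wt x) *: sm_act M x u.
Proof.
move=> xa hx hu; rewrite (rep_even_comm (@sm_rep M) _ h0 xa) hx hu.
by rewrite !linearZ scale_lfunE /= -scalerDl.
Qed.

Lemma weight_sgn c u : sm_act M h u = c *: u -> sm_act M h (sgn M u) = c *: sgn M u.
Proof.
by move=> hu; have := sgn_act (M := M) u h0; rewrite expr0 scale1r hu linearZ.
Qed.

Lemma weight_word s c u : {subset s <= g1} ->
  (forall x, x \in s -> ls_br g h x = wt x *: x) -> sm_act M h u = c *: u ->
  sm_act M h (mword s u) = (c + \sum_(x <- s) wt x) *: mword s u.
Proof.
elim: s => [|x s IHs] s1 hs hu; first by rewrite word_nil big_nil addr0.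
rewrite word_cons (weight_step (s1 x (mem_head _ _)) (hs x (mem_head _ _))
  (IHs _ _ hu)).
- by rewrite big_cons -addrA [in RHS](addrC (wt x)).
- by move=> y ys; rewrite s1 // inE ys orbT.
- by move=> y ys; rewrite hs // inE ys orbT.
Qed.

Definition kills_above (f : 'Hom(M, N)) (m : K) : Prop :=
  forall u c, sm_act M h u = c *: u -> m < c -> f u = 0.

Lemma kills_above_conj f m : kills_above f m -> kills_above (sgn_conj f) m.
Proof.
by move=> fm u c hu mc; rewrite sgn_conjE (fm _ c (weight_sgn hu) mc) linear0.
Qed.

(** In the action of [x] on [f], the term applying [f] after [x] dies, since [x] raises the
    eigenvalue above [m]. Hence on eigenvalues at least [m] the whole word acts after [f]. *)
Lemma kills_above_raise xs f m : {subset xs <= g1} ->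
  (forall x, x \in xs -> ls_br g h x = wt x *: x /\ 0 < wt x) ->
  kills_above f m ->
  kills_above (hword xs f) m /\
  forall u c, sm_act M h u = c *: u -> m <= c ->
    hword xs f u = word (sm_act N) xs (f u).
Proof.
elim: xs => [|x xs IHxs] xs1 hxs fm.
  by rewrite word_nil; split=> // u c _ _; rewrite word_nil.
have [x1 [hx wx]] := (xs1 x (mem_head _ _), hxs x (mem_head _ _)).
have {}xs1 : {subset xs <= g1} by move=> y ys; rewrite xs1 // inE ys orbT.
have {}hxs y : y \in xs -> ls_br g h y = wt y *: y /\ 0 < wt y.
  by move=> ys; apply: hxs; rewrite inE ys orbT.
have [km eqm] := IHxs xs1 hxs fm; split=> u c hu mc; rewrite word_cons (hom_repE _ _ x1).
  rewrite (km _ _ hu mc) linear0 (kills_above_conj km (weight_step x1 hx hu)) ?subrr //.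
  by rewrite (lt_trans mc) // ltrDl.
rewrite (eqm _ _ hu mc) (kills_above_conj km (weight_step x1 hx hu)).
  by rewrite subr0 word_cons.
by rewrite (le_lt_trans mc) // ltrDl.
Qed.

(** The opposite situation: the terms in which a letter acts after [f] die, because the eigenvalue
    has not yet been lowered enough. Only the term with the whole word applied before [f] survives,
    up to sign and twist. *)
Lemma kills_above_lower ys f m : odd_abelian <<ys>> ->
  (forall y, y \in ys -> ls_br g h y = wt y *: y /\ wt y < 0) ->
  kills_above f m ->
  forall u c, sm_act M h u = c *: u -> c + \sum_(y <- ys) wt y = m ->
    hword ys f u
      = (-1) ^+ size ys *: sgn_twist (odd (size ys)) f (mword ys u).
Proof.
move=> AP hys fm.
have ysA : {subset ys <= <<ys>>%VS} by move=> y; exact: memv_span.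
have A1 : {subset <<ys>>%VS <= g1} by case: AP => /subvP.
(* Each negative letter raises the bound above which the homomorphism vanishes by minus its
   weight. *)
suff aux l : {subset l <= ys} -> kills_above (hword l f) (m - \sum_(y <- l) wt y)
    /\ forall u c, sm_act M h u = c *: u -> c + \sum_(y <- l) wt y = m ->
    hword l f u = (-1) ^+ size l *: sgn_twist (odd (size l)) f (mword l u).
  by have [_] := aux ys (fun _ => id).
elim: l => [|y l IHl] lys.
  rewrite big_nil subr0 !word_nil; split=> // u c _ _.
  by rewrite word_nil scale1r.
have yys := lys y (mem_head _ _); have [hy wy] := hys y yys.
have y1 := A1 y (ysA y yys).
have {}lys : {subset l <= ys} by move=> x xl; rewrite lys // inE xl orbT.
have lA : {subset l <= <<ys>>%VS} by move=> x /lys/ysA.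
have [km eqm] := IHl lys; rewrite big_cons; split=> u c hu mc.
  have mc' : m - \sum_(y <- l) wt y < c + wt y.
    by rewrite -ltrBlDr -addrA -opprD [X in - X]addrC.
  rewrite word_cons (hom_repE _ _ y1) (kills_above_conj km (weight_step y1 hy hu)) //.
  rewrite (km _ _ hu) ?linear0 ?oppr0 ?addr0 //.
  by rewrite (lt_trans mc') // gtrDl.
rewrite word_cons (hom_repE _ _ y1) (km _ _ hu); last first.
  by rewrite -mc addrA addrK gtrDl.
rewrite linear0 sub0r [sgn_twist _ _]/= sgn_conjE.
rewrite (eqm _ _ (weight_sgn (weight_step y1 hy hu))) -?addrA //.
have -> : mword l (sgn M (sm_act M y u)) = sgn M (mword (y :: l) u).
  rewrite word_cons; apply: (can_inj (@signrZK _ _ (odd (size l)))).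
  rewrite signr_odd -word_sgn; last by move=> x /lA/A1.
  rewrite (word_anticomm (@sm_rep M) AP) //; last exact: ysA.
  by rewrite linearZ.
rewrite linearZ /= exprS mulN1r scaleNr; congr (- (_ *: _)).
by rewrite -sgn_conjE -[sgn_conj _]/(sgn_twist true _) sgn_twistD addTb.
Qed.

End Module.
End Weights.

(** * The parity-preserving part of a homomorphism *)

Section EvenPart.
Variables (K : numFieldType) (g : lieSuperalgebra K) (M N : superModule g).
Local Notation g0 := (ls_part g false).
Local Notation g1 := (ls_part g true).

(** The projection onto parity-preserving maps. It is needed because a g-invariant homomorphism may
    have an odd component, whereas morphisms must preserve parity. *)
Definition even_part (f : 'Hom(M, N)) : 'Hom(M, N) := 2^-1 *: (f + sgn_conj f).

Lemma even_partE f v : even_part f v = 2^-1 *: (f v + sgn N (f (sgn M v))).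
Proof. by rewrite scale_lfunE add_lfunE sgn_conjE. Qed.

Lemma even_part_linear : linear even_part.
Proof.
move=> k f h; rewrite /even_part linearP /= [k *: (2^-1 *: _)]scalerA mulrC -scalerA.
by rewrite -scalerDr; congr (_ *: _); rewrite scalerDr addrACA.
Qed.

HB.instance Definition _ := GRing.isLinear.Build K 'Hom(M, N) 'Hom(M, N) _
  even_part even_part_linear.

Lemma even_part_morphism f : (forall x, hom_rep M N x f = 0) -> is_morphism (even_part f).
Proof.
move=> invf; have comm a x v : x \in ls_part g a ->
    sm_act N x (f v) = sgn_twist a f (sm_act M x v).
  by move=> xa; apply/eqP; rewrite -subr_eq0 -(hom_repE _ _ xa) invf zero_lfunE.
split=> [a v va|x v].
  apply: (parity_mem (sm_part_cap N) (sm_part_sum N)); rewrite -/(sgn N).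
  rewrite even_partE linearZ linearD /= sgnK (sgnE va) linearZ /=.
  rewrite [sgn N (_ *: _)]linearZ /= [RHS]scalerA mulrC -scalerA; congr (_ *: _).
  by rewrite scalerDr scalerA -expr2 sqrr_sign scale1r addrC.
suff hom a y : y \in ls_part g a -> even_part f (sm_act M y v) = sm_act N y (even_part f v).
  have [x0 [x1 [x0P x1P ->]]] := homogeneous_decomposition (ls_part_sum g) x.
  by rewrite !linearD !add_lfunE linearD /= (hom _ _ x0P) (hom _ _ x1P).
move=> ya; rewrite !even_partE [sm_act N y (_ *: _)]linearZ /= [sm_act N y (_ + _)]linearD /=.
congr (_ *: _).
have ycomm := comm _ _ _ ya; have ysgn (L : superModule g) := @sgn_act _ _ L a y ^~ ya.
have -> : sm_act N y (sgn N (f (sgn M v)))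
    = (-1) ^+ a *: sgn N (sgn_twist a f (sm_act M y (sgn M v))).
  by rewrite -ycomm ysgn scalerA -expr2 sqrr_sign scale1r.
have -> : sm_act M y (sgn M v) = (-1) ^+ a *: sgn M (sm_act M y v).
  by rewrite ysgn scalerA -expr2 sqrr_sign scale1r.
rewrite ycomm [sgn_twist a f (_ *: _)]linearZ /= [sgn N (_ *: _)]linearZ /=.
rewrite scalerA -expr2 sqrr_sign scale1r; case: (a) => /=.
  by rewrite !sgn_conjE !sgnK addrC.
by [].
Qed.

End EvenPart.

(** * The relative trace *)

Section Composition.
Variables (K : numFieldType) (g : lieSuperalgebra K).
Local Notation g0 := (ls_part g false).
Local Notation g1 := (ls_part g true).

Lemma morphism_sgn (M N : superModule g) (p : 'Hom(M, N)) v :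
  is_morphism p -> p (sgn M v) = sgn N (p v).
Proof.
case=> pP _.
have [v0 [v1 [v0P v1P ->]]] := homogeneous_decomposition (sm_part_sum M) v.
rewrite !linearD /= (sgnE v0P) (sgnE v1P) !linearZ /=.
by rewrite (sgnE (pP _ _ v0P)) (sgnE (pP _ _ v1P)).
Qed.

Lemma even_part_compl (M N L : superModule g) (p : 'Hom(N, L)) (f : 'Hom(M, N)) :
  is_morphism p -> even_part (p \o f)%VF = (p \o even_part f)%VF.
Proof.
move=> pP; apply/lfunP => v; rewrite comp_lfunE !even_partE !comp_lfunE.
by rewrite [p (_ *: _)]linearZ /= [p (_ + _)]linearD /= (morphism_sgn _ pP).
Qed.

Lemma hom_rep_compl (M N L : superModule g) (p : 'Hom(N, L)) (f : 'Hom(M, N)) a x :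
  is_morphism p -> x \in ls_part g a ->
  hom_rep M L x (p \o f)%VF = (p \o hom_rep M N x f)%VF.
Proof.
move=> pP xa; apply/lfunP => v; rewrite comp_lfunE !(hom_repE _ _ xa) linearB /=.
rewrite comp_lfunE pP.2; congr (_ - _); case: (a); rewrite /= ?sgn_conjE ?comp_lfunE //.
by rewrite (morphism_sgn _ pP).
Qed.

Lemma word_compl (M N L : superModule g) (p : 'Hom(N, L)) (f : 'Hom(M, N)) s :
  is_morphism p -> {subset s <= g1} ->
  word (hom_rep M L) s (p \o f)%VF = (p \o word (hom_rep M N) s f)%VF.
Proof.
move=> pP; elim: s => [|x s IHs] s1; first by rewrite !word_nil.
rewrite !word_cons IHs => [|y ys]; last by rewrite s1 // inE ys orbT.
by rewrite (hom_rep_compl _ pP (s1 x (mem_head _ _))).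
Qed.

End Composition.

(* [xs] and [ys] are bases of the positive and the negative part of g1, made of
   eigenvectors of ad h, whose eigenvalues are recorded by [wt]. *)
Record polarization (K : numFieldType) (g : lieSuperalgebra K) (h : g)
    (wt : g -> K) (xs ys : seq g) : Prop := Polarization {
  pol_center : in_even_center h;
  pol_sum : (<<xs>> + <<ys>> = ls_part g true)%VS;
  pol_abelian_pos : odd_abelian <<xs>>;
  pol_abelian_neg : odd_abelian <<ys>>;
  pol_norm_pos : even_normalized <<xs>>;
  pol_norm_neg : even_normalized <<ys>>;
  pol_free_pos : free xs;
  pol_free_neg : free ys;
  pol_pos : forall x, x \in xs -> ls_br g h x = wt x *: x /\ 0 < wt x;
  pol_neg : forall y, y \in ys -> ls_br g h y = wt y *: y /\ wt y < 0
}.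

Section Trace.
Variables (K : numFieldType) (g : lieSuperalgebra K) (h : g) (wt : g -> K).
Variables (xs ys : seq g).
Hypothesis pol : polarization h wt xs ys.
Local Notation g0 := (ls_part g false).
Local Notation g1 := (ls_part g true).

Lemma pol_odd_pos : {subset xs <= g1}.
Proof.
by move=> x xxs; have [/subvP A1 _] := pol_abelian_pos pol; rewrite A1 ?memv_span.
Qed.

Lemma pol_odd_neg : {subset ys <= g1}.
Proof.
by move=> y yys; have [/subvP A1 _] := pol_abelian_neg pol; rewrite A1 ?memv_span.
Qed.

(* g0 acts on f through the dual of the top exterior power of g1. *)
Definition dual_character (M N : superModule g) (f : 'Hom(M, N)) : Prop :=
  forall z, z \in g0 -> hom_rep M N z f = - (ad_trace xs z + ad_trace ys z) *: f.

Definition relative_trace (M N : superModule g) (f : 'Hom(M, N)) : 'Hom(M, N) :=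
  even_part (word (hom_rep M N) ys (word (hom_rep M N) xs f)).

Lemma relative_trace_linear (M N : superModule g) : linear (@relative_trace M N).
Proof. by move=> k f1 f2; rewrite /relative_trace !linearP. Qed.

HB.instance Definition _ (M N : superModule g) :=
  GRing.isLinear.Build K 'Hom(M, N) 'Hom(M, N) _ (@relative_trace M N)
  (@relative_trace_linear M N).

Lemma relative_trace_compl (M N L : superModule g) (p : 'Hom(N, L)) (f : 'Hom(M, N)) :
  is_morphism p -> relative_trace (p \o f)%VF = (p \o relative_trace f)%VF.
Proof.
move=> pP; rewrite /relative_trace (word_compl _ pP pol_odd_pos).
by rewrite (word_compl _ pP pol_odd_neg) even_part_compl.
Qed.

(** Multiplying [f] by the positive top product cancels one half of its character and leaves what
    [word_even0] requires. The full product is then killed by g0, by the negative part as a top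
    product, and by the positive part through [word_odd0], since the positive letters kill [u]. *)
Lemma relative_trace_morphism (M N : superModule g) (f : 'Hom(M, N)) :
  dual_character f -> is_morphism (relative_trace f).
Proof.
move=> fP; apply: even_part_morphism.
set r := hom_rep M N; have rP : bracket_rep r := @hom_rep_bracket _ _ M N.
set u := word r xs f; have [h0 _] := pol_center pol.
have xsA x : x \in xs -> x \in <<xs>>%VS by exact: memv_span.
have ysA y : y \in ys -> y \in <<ys>>%VS by exact: memv_span.
have uP z : z \in g0 -> r z u = - ad_trace ys z *: u.
  move=> z0; rewrite (word_ad_trace rP _ (pol_abelian_pos pol) (pol_norm_pos pol) z0).
  by rewrite (fP z z0) linearZ /= -scalerDl opprD addrAC addNr add0r.
have inv0 z : z \in g0 -> r z (word r ys u) = 0.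
  by apply: word_even0 => //; [exact: pol_abelian_neg pol | exact: pol_norm_neg pol].
have inv_neg y : y \in <<ys>>%VS -> r y (word r ys u) = 0.
  by move=> yA; apply: (word_killed rP (pol_abelian_neg pol)).
have inv_pos x : x \in <<xs>>%VS -> r x (word r ys u) = 0.
  move=> /(@coord_span _ _ _ (in_tuple xs)) ->.
  rewrite linear_sum sum_lfunE big1 // => i _.
  have xi : xs`_i \in xs by rewrite mem_nth.
  have [hx wx] := pol_pos pol xi.
  rewrite linearZ scale_lfunE /=.
  rewrite (word_odd0 rP (pol_abelian_neg pol) (pol_norm_neg pol) uP h0
    (pol_odd_pos xi) hx (lt0r_neq0 wx)) ?scaler0 //.
  exact: (word_dupl rP (pol_abelian_pos pol)).
move=> x; have [x0 [x1 [x0P + ->]]] := homogeneous_decomposition (ls_part_sum g) x.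
rewrite -(pol_sum pol) => /memv_addP[a aA [b bA ->]].
by rewrite !linearD !add_lfunE inv0 // inv_pos // inv_neg // !addr0.
Qed.

Lemma relative_trace_projective (M : superModule g) (f : 'End(M)) :
  inF M -> dual_character f -> relative_trace f = \1%VF -> projective_inF M.
Proof.
move=> ssM fP f1; split=> // N L p q ssN ssL pP qP psurj.
(* As [p] commutes with g0, the character is zero and [S] is a g0-equivariant section of [p]. *)
have [|S [pS SP]] := @even_pseudo_inverse K g N L (sm_act N) (sm_act L) p
    (fun=> 0) ssN ssL.
  by move=> z v z0; rewrite scale0r addr0 pP.2.
pose s := (S \o q)%VF.
have ps : (p \o s)%VF = q.
  apply/lfunP => v; rewrite !comp_lfunE.
  have : q v \in limg p by rewrite psurj memvf.
  by case/limgP => w ->; rewrite pS.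
exists (relative_trace (s \o f)%VF); split.
  apply: relative_trace_morphism => z z0; apply/lfunP => v.
  rewrite (hom_repE _ _ z0) scale_lfunE !comp_lfunE /=.
  rewrite SP // scale0r subr0 -qP.2.
  have := fP z z0 => /lfunP/(_ v); rewrite (hom_repE _ _ z0) scale_lfunE /= => fz.
  by rewrite -linearB -linearB /= fz !linearZ.
(* p Tr(s f) = Tr(p s f) = Tr(q f) = q Tr(f) = q. *)
by rewrite -relative_trace_compl // comp_lfunA ps relative_trace_compl // f1 comp_lfun1r.
Qed.

End Trace.

(** * Projectivity *)

Section Projectivity.
Variables (K : numClosedFieldType) (g : lieSuperalgebra K) (h : g) (wt : g -> K).
Variables (xs ys : seq g) (M : superModule g).
Hypothesis pol : polarization h wt xs ys.
Hypothesis ssM : inF M.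
Hypothesis exM : forall x v, x \in ls_part g true -> ls_br g x x = 0 -> x != 0 ->
  sm_act M x v = 0 -> exists w, v = sm_act M x w.
Local Notation g0 := (ls_part g false).
Local Notation g1 := (ls_part g true).
Local Notation act := (sm_act M).
Local Notation mword := (word (sm_act M)).
Local Notation Tr := (@relative_trace K g xs ys M M).

Let h0 : h \in g0. Proof. by case: (pol_center pol). Qed.

Lemma ad_trace_weight : ad_trace ys h = \sum_(y <- ys) wt y.
Proof.
rewrite (big_nth 0) big_mkord; apply: eq_bigr => i _.
have [-> _] := pol_neg pol (mem_nth 0 (ltn_ord i)).
rewrite linearZ /= (@coord_free _ _ _ (in_tuple ys)) ?(pol_free_neg pol) //.
by rewrite eqxx mulr1.
Qed.

Lemma exact_abelian A : odd_abelian A -> forall x v, x \in A -> x != 0 ->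
  act x v = 0 -> exists w, v = act x w.
Proof. by case=> /subvP A1 AA x v xA; apply: exM; [exact: A1|exact: AA]. Qed.

Section Image.
Variable psi : 'End(M).
Hypotheses (psiP : is_morphism psi) (psi_neq0 : psi != 0).
Hypothesis psi_inj : (limg psi :&: lker psi = 0)%VS.
Local Notation W := (limg psi).

Let actW x v : v \in W -> act x v \in W.
Proof.
by move=> /limgP[u ->]; apply/limgP; exists (act x u); rewrite psiP.2.
Qed.

(** Either v + [sgn M v] is a nonzero even eigenvector, or it vanishes and [v] is odd. *)
Lemma limg_graded_eigenvector c (v : M) : v \in W -> act h v = c *: v -> v != 0 ->
  exists u (a : bool), [/\ u \in W, act h u = c *: u, u != 0 & sgn M u = (-1) ^+ a *: u].
Proof.
move=> vW hv v0.
have hs : act h (sgn M v) = c *: sgn M v by exact: (weight_sgn h0 hv).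
have sW : sgn M v \in W.
  case/limgP: vW => u ->; apply/limgP; exists (sgn M u).
  by rewrite (morphism_sgn _ psiP).
have [s0|s0] := eqVneq (v + sgn M v) 0.
  exists v, true; split=> //; rewrite expr1 scaleN1r; apply/eqP.
  by rewrite -addr_eq0 addrC s0.
exists (v + sgn M v), false; split=> //; first by rewrite memvD.
  by rewrite linearD /= hv hs scalerDr.
by rewrite linearD /= sgnK expr0 scale1r addrC.
Qed.

Lemma exists_trace_fixing :
  exists f v, [/\ dual_character xs ys f, v \in W, v != 0 & Tr f v = v].
Proof.
have Wh : (act h @: W <= W)%VS by apply/subvP => _ /memv_imgP[v vW ->]; exact: actW.
have W0 : W != 0%VS.
  apply: contraNneq psi_neq0 => W0; apply/eqP/lfunP => v; apply/eqP.
  by rewrite zero_lfunE -memv0 -W0 memv_img ?memvf.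
have [c [[v' [v'W hv' v'0]] cmax]] := exists_maximal_eigenvalue Wh W0.
(* With [v] homogeneous, taking the even part at the end does not change the value of the trace at
   [v]. *)
have [v [a [vW hv v0 sv]]] := limg_graded_eigenvector v'W hv' v'0.
have above d u : u \in W -> act h u = d *: u -> c < d -> u = 0.
  by move=> uW hu cd; apply/eqP; apply: contraLR cd; exact: cmax hu.
pose V := (W :&: lker (act h - c *: \1%VF))%VS.
have VP u : (u \in V) = (u \in W) && (act h u == c *: u).
  by rewrite memv_cap memv_ker add_lfunE opp_lfunE scale_lfunE id_lfunE subr_eq0.
have stV : even_stable act V.
  apply/even_stableP => z u z0; rewrite !VP => /andP[uW /eqP hu].
  rewrite actW // (rep_even_comm (@sm_rep _ _ M) _ h0 z0) hu.
  case: (pol_center pol) => _ hz; rewrite hz // linear0 zero_lfunE addr0.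
  by rewrite linearZ /=.
have [C [stC capC sumC]] := even_stable_complement ssM stV.
(* [P] is the g0-equivariant projection onto [V]. *)
pose P : 'End(M) := daddv_pi V C.
have PV u : P u \in V by exact: memv_pi.
have Pid u : u \in V -> P u = u by exact: daddv_pi_id.
have Pact z u : z \in g0 -> P (act z u) = act z (P u).
  move=> z0; have : u \in (V + C)%VS by rewrite sumC memvf.
  case/memv_addP => u1 u1V [u2 u2C ->]; rewrite linearD /= !daddv_piD //.
  - by move/even_stableP: stV; apply.
  - by move/even_stableP: stC; apply.
(* h - (c - wt y) is bijective on W, and (P y) (h - (c - wt y)) = 0 there. *)
have Py y u : y \in ys -> u \in W -> P (act y u) = 0.
  move=> yys uW; have [hy wy] := pol_neg pol yys; have y1 := pol_odd_neg pol yys.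
  pose d := c - wt y; pose k := act h - d *: \1%VF.
  have kE t : k t = act h t - d *: t.
    by rewrite add_lfunE opp_lfunE scale_lfunE id_lfunE.
  have kW : (k @: W)%VS = W.
    apply/eqP; rewrite eqEdim; apply/andP; split.
      apply/subvP => _ /memv_imgP[t tW ->].
      by rewrite kE memvB ?memvZ ?actW.
    rewrite [\dim (k @: W)%VS]limg_dim_eq //; apply/vspaceP => t; rewrite memv0.
    apply/idP/eqP => [|->]; last exact: mem0v.
    rewrite memv_cap memv_ker kE subr_eq0 => /andP[tW /eqP ht].
    by apply: (above d t) => //; rewrite ltrDl oppr_gt0.
  move: uW; rewrite -kW => /memv_imgP[t tW ->]; rewrite kE.
  have := PV (act y t); rewrite VP => /andP[_ /eqP hP].
  have := Pact h (act y t) h0; rewrite hP.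
  rewrite (rep_even_comm (@sm_rep _ _ M) _ h0 y1) hy linearZ scale_lfunE linearD.
  rewrite linearZ /= => /(canRL (addrK _)) Pht.
  by rewrite linearB linearZ /= linearB linearZ /= Pht -scalerBl subrr.
have ysA : {subset ys <= <<ys>>%VS} by move=> y; exact: memv_span.
(* If the negative top product kills [u], then [u] lies in the sum of the images of the [ys], so psi
   u lies in the sum of the y W, which [P] annihilates. But psi u is in [V], so it is 0, and
   [psi_inj] gives u = 0. *)
have word_inj u : u \in V -> mword ys u = 0 -> u = 0.
  move=> uV /(word_kernel (@sm_rep _ _ M) (pol_abelian_neg pol)
    (exact_abelian (pol_abelian_neg pol)) ysA (pol_free_neg pol)) us.
  have [uW hu] : u \in W /\ act h u = c *: u by move: uV; rewrite VP => /andP[? /eqP].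
  have psiu : psi u = 0.
    have <- : P (psi u) = psi u.
      by rewrite Pid // VP memv_img ?memvf //= -psiP.2 hu linearZ.
    move: us; elim: (ys) (fun y => @Py y) u {uV uW hu} => [|y l IHl] Pyl u.
      by rewrite big_nil memv0 => /eqP->; rewrite !linear0.
    rewrite big_cons => /memv_addP[_ /limgP[u1 ->] [u2 u2l ->]].
    rewrite linearD linearD /= psiP.2 Pyl ?mem_head ?memv_img ?memvf // add0r.
    by apply: IHl => // z t zl; apply: Pyl; rewrite inE zl orbT.
  by apply/eqP; rewrite -memv0 -psi_inj memv_cap uW memv_ker psiu eqxx.
have xsA : {subset xs <= <<xs>>%VS} by move=> x; exact: memv_span.
(* A positive letter would take [v] to an eigenvalue larger than [c], so it kills [v]. *)
have [v1 v1E] : exists v1, v = mword xs v1.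
  apply: (killed_in_word (@sm_rep _ _ M) (pol_abelian_pos pol)
    (exact_abelian (pol_abelian_pos pol)) xsA (pol_free_pos pol)) => x xxs.
  have [hx wx] := pol_pos pol xxs.
  apply: (above (c + wt x)); rewrite ?actW ?ltrDl //.
  exact: (weight_step h0 (pol_odd_pos pol xxs) hx hv).
have [S1 [S1K S1P]] : exists S : 'End(M), (forall u, mword xs (S (mword xs u)) = mword xs u)
    /\ forall z u, z \in g0 -> act z (S u) = S (act z u) - ad_trace xs z *: S u.
  apply: even_pseudo_inverse => // z u z0.
  apply: (word_ad_trace (@sm_rep _ _ M) _ (pol_abelian_pos pol) (pol_norm_pos pol) z0).
(* The negative top product on [V], extended by 0 on [C] so as to be defined on all of [M]. *)
pose T := (mword ys \o P)%VF.
have [S2 [S2K S2P]] : exists S : 'End(M), (forall u, T (S (T u)) = T u)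
    /\ forall z u, z \in g0 -> act z (S u) = S (act z u) - ad_trace ys z *: S u.
  apply: even_pseudo_inverse => // z u z0; rewrite /T !comp_lfunE Pact //.
  apply: (word_ad_trace (@sm_rep _ _ M) _ (pol_abelian_neg pol) (pol_norm_neg pol) z0).
(* [S2] undoes the negative top product modulo the kernel of [T], [P] returns to [V], and [S1] picks
   a preimage under the positive one. The two twists add up to the dual character. *)
pose f0 := (S1 \o P \o S2)%VF.
have f0P : dual_character xs ys f0.
  move=> z z0; apply/lfunP => u; rewrite (hom_repE _ _ z0) scale_lfunE /=.
  rewrite !comp_lfunE S1P // -Pact // S2P // !linearB !linearZ /= ?scalerN.
  by rewrite addrAC [X in X - _]addrAC subrr sub0r scaleNr scalerDl opprD addrC.
have f0v : mword xs (f0 (mword ys v)) = v.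
  have vV : v \in V by rewrite VP vW hv eqxx.
  have -> : f0 (mword ys v) = S1 v.
    rewrite !comp_lfunE; congr (S1 _); apply/eqP; rewrite -subr_eq0; apply/eqP.
    apply: word_inj; first by rewrite memvB.
    have := S2K v; rewrite /T !comp_lfunE (Pid v) // linearB /= => ->.
    by rewrite subrr.
  by rewrite v1E S1K.
(* The eigenvalue of [h] on the negative top product of [v]. Since [S2] shifts eigenvalues by minus
   the sum of the negative weights and [P] lands in eigenvalue [c], [f0] vanishes above [m]. *)
pose m := c + \sum_(y <- ys) wt y.
have f0m : kills_above h f0 m.
  move=> u d hu md; rewrite !comp_lfunE (_ : P (S2 u) = 0) ?linear0 //.
  have := PV (S2 u); rewrite VP => /andP[_ /eqP].
  rewrite -Pact // S2P // hu [S2 (_ *: _)]linearZ /= -scalerBl [P (_ *: _)]linearZ /=.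
  rewrite ad_trace_weight.
  move/eqP; rewrite -subr_eq0 -scalerBl scaler_eq0 => /orP[|/eqP//].
  by rewrite -addrA -opprD [_ + c]addrC subr_eq0 gt_eqF.
(* This twist cancels the one produced by [kills_above_lower]. *)
pose b := odd (size ys).
pose f1 := sgn_twist b f0.
have f1P : dual_character xs ys f1.
  move=> z z0; have := sgn_twist_hom_rep b f0 z0.
  by rewrite expr0 scale1r /f1 => <-; rewrite f0P // /b; case: (odd _); rewrite /= ?linearZ.
have f1m : kills_above h f1 m.
  by rewrite /f1 /b; case: (odd _) => //=; apply: kills_above_conj.
have hpos x : x \in xs -> ls_br g h x = wt x *: x /\ 0 < wt x by exact: (pol_pos pol).
have hneg y : y \in ys -> ls_br g h y = wt y *: y /\ wt y < 0 by exact: (pol_neg pol).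
(* The negative word moves before the homomorphism and the positive one after it, which reduces the
   value to [f0v] up to sign. *)
have [e eE] : exists e : bool,
    word (hom_rep M M) ys (word (hom_rep M M) xs f1) v = (-1) ^+ e *: v.
  have [k1 _] := kills_above_raise h0 (pol_odd_pos pol) hpos f1m.
  have [_ k0] := kills_above_raise h0 (pol_odd_pos pol) hpos f0m.
  rewrite (kills_above_lower h0 (pol_abelian_neg pol) hneg k1 hv) //.
  rewrite sgn_twist_word; last exact: pol_odd_pos pol.
  rewrite -/b /f1 sgn_twistD addbb scale_lfunE.
  rewrite (k0 _ m) ?f0v ?scalerA -?exprD //.
    by exists (odd (size ys + b * size xs)); rewrite signr_odd.
  by apply: (weight_word h0 (pol_odd_neg pol)) => // y /hneg[].
exists ((-1) ^+ e *: f1), v; split=> //.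
  by move=> z z0; rewrite linearZ /= f1P // !scalerA mulrC.
suff TrE : Tr f1 v = (-1) ^+ e *: v.
  by rewrite [Tr _]linearZ scale_lfunE /= TrE scalerA -expr2 sqrr_sign scale1r.
rewrite /relative_trace even_partE sv; move: (word _ ys _) eE => Phi PhiE.
rewrite [Phi (_ *: v)]linearZ /= PhiE scalerA [sgn M (_ *: v)]linearZ /= sv.
rewrite scalerA mulrAC -expr2 sqrr_sign mul1r -mulr2n -scaler_nat scalerA.
by rewrite mulVf ?pnatr_eq0 // scale1r.
Qed.

End Image.

(** The maps 1 - Tr f are closed under composition, because Tr f1 composed with Tr f2 is the trace
    of Tr f1 composed with [f2]. *)
Let comp_idB (f1 f2 : 'End(M)) : is_morphism (Tr f1) ->
  ((\1 - Tr f1) \o (\1 - Tr f2))%VF = \1%VF - Tr (f1 + f2 - (Tr f1 \o f2)%VF).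
Proof.
move=> f1P; have -> : Tr (f1 + f2 - (Tr f1 \o f2)%VF) = Tr f1 + Tr f2 - Tr (Tr f1 \o f2)%VF.
  by rewrite linearB linearD.
rewrite (relative_trace_compl pol _ f1P).
rewrite comp_lfunDl comp_lfunNl !comp_lfunDr !comp_lfunNr !comp_lfun1l comp_lfun1r.
by rewrite opprB !opprD opprK !addrA [LHS]addrAC; congr (_ + _); rewrite addrAC.
Qed.

Lemma dual_character_add (f1 f2 : 'End(M)) k :
  dual_character xs ys f1 -> dual_character xs ys f2 ->
  dual_character xs ys (k *: f1 + f2).
Proof.
by move=> f1P f2P z z0; rewrite linearP /= f1P // f2P // scalerDr !scalerA mulrC.
Qed.

Lemma dual_character_compl (p f : 'End(M)) : is_morphism p ->
  dual_character xs ys f -> dual_character xs ys (p \o f)%VF.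
Proof.
by move=> pP fP z z0; rewrite (hom_rep_compl _ pP z0) fP // comp_lfunZr.
Qed.

(** Induction on the rank of psi = 1 - Tr f, starting from f = 0. Composing with a map 1 - Tr f1
    that kills a nonzero vector of the image of psi lowers the rank. If psi is injective on its
    image, [exists_trace_fixing] supplies [f1]; otherwise f1 = f will do. *)
Lemma exists_relative_trace_id :
  exists f : 'End(M), dual_character xs ys f /\ Tr f = \1%VF.
Proof.
suff aux n (f : 'End(M)) : dual_character xs ys f ->
    (\dim (limg (\1%VF - Tr f)%R) < n)%N ->
    exists f : 'End(M), dual_character xs ys f /\ Tr f = \1%VF.
  apply: (aux _ 0 _ (ltnSn _)) => z z0.
  by rewrite linear0 scaler0.
elim: n f => // n IHn f fP; rewrite ltnS => rk.
set psi := (_ - Tr f) in rk.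
have [psi0|psi0] := eqVneq psi 0.
  by exists f; split=> //; apply/eqP; rewrite eq_sym -subr_eq0 -/psi psi0.
have step f1 : dual_character xs ys f1 ->
    (\dim (limg ((\1%VF - Tr f1)%R \o psi)%VF) < \dim (limg psi))%N ->
    exists f : 'End(M), dual_character xs ys f /\ Tr f = \1%VF.
  move=> f1P; have T1P := relative_trace_morphism pol f1P.
  rewrite comp_idB // => dim_lt; apply: IHn (leq_trans dim_lt rk).
  rewrite -scaleN1r addrC; apply: dual_character_add.
    exact: dual_character_compl.
  by rewrite -[f1]scale1r; apply: dual_character_add.
have psiP : is_morphism psi.
  have [T1 T2] := relative_trace_morphism pol fP; split=> [a v va|x v].
    by rewrite add_lfunE opp_lfunE id_lfunE memvB // T1.
  by rewrite !add_lfunE !opp_lfunE !id_lfunE T2 linearB.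
have rank_lt f1 v : dual_character xs ys f1 -> v \in limg psi -> v != 0 ->
    (\1%VF - Tr f1) v = 0 -> exists f : 'End(M), dual_character xs ys f /\ Tr f = \1%VF.
  move=> f1P vpsi v0 v1; apply: (step f1 f1P); rewrite limg_comp.
  rewrite -[X in (_ < X)%N](limg_ker_dim (\1%VF - Tr f1)) -[X in (X < _)%N]add0n ltn_add2r.
  rewrite lt0n dimv_eq0; apply: contraNneq v0 => cap0.
  by rewrite -memv0 -cap0 memv_cap vpsi memv_ker v1 eqxx.
have [cap0|] := eqVneq (limg psi :&: lker psi)%VS 0%VS.
  have [f1 [v [f1P vpsi v0 Tv]]] := exists_trace_fixing psiP psi0 cap0.
  by apply: (rank_lt f1 v) => //; rewrite add_lfunE opp_lfunE id_lfunE Tv subrr.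
rewrite -vpick0 => v0; have := memv_pick (limg psi :&: lker psi)%VS.
rewrite memv_cap memv_ker => /andP[vpsi /eqP psiv].
exact: (rank_lt f _ fP vpsi v0 psiv).
Qed.

Lemma polarized_projective : projective_inF M.
Proof.
have [f [fP f1]] := exists_relative_trace_id.
exact: (relative_trace_projective pol ssM fP f1).
Qed.

End Projectivity.

(** * Splitting g1 by the sign of the eigenvalues of ad h *)

Section Polarize.
Variables (K : numFieldType) (g : lieSuperalgebra K) (h : g) (n : nat)
  (e : n.-tuple g) (a : 'I_n -> K).
Local Notation g0 := (ls_part g false).
Local Notation g1 := (ls_part g true).
Hypotheses (hC : in_even_center h) (eB : basis_of g1 e).
Hypotheses (he : forall i, ls_br g h (tnth e i) = a i *: tnth e i).

(** Weights are looked up by vector instead of by index, as [polarization] expects, with default 0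
    off the basis. *)
Definition basis_weight (x : g) : K :=
  if [pick i | tnth e i == x] is Some i then a i else 0.
Local Notation wt := basis_weight.

Lemma basis_weightE i : wt (tnth e i) = a i.
Proof.
rewrite /basis_weight; case: pickP => [j /eqP ij|/(_ i)]; last by rewrite eqxx.
by congr (a _); exact: (tuple_uniqP _ (free_uniq (basis_free eB))).
Qed.

Lemma basis_weightP x : x \in (e : seq g) -> ls_br g h x = wt x *: x.
Proof. by move=> /tnthP[i ->]; rewrite basis_weightE he. Qed.

Let e1 x : x \in (e : seq g) -> x \in g1.
Proof. exact: basis_mem eB. Qed.

Section Sign.
Variable P : pred K.
Local Notation s := [seq x <- e | P (wt x)].

Lemma sign_part_free : free s.
Proof. exact/filter_free/(basis_free eB). Qed.

(** The bracket of two basis vectors lies in g0, so [h] annihilates it; by the Jacobi identity ad h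
    also multiplies it by the sum of the two weights, which is nonzero. *)
Lemma sign_part_abelian : {in P &, forall c d, c + d != 0} -> odd_abelian <<s>>.
Proof.
move=> P0; split.
  by apply/span_subvP => x; rewrite mem_filter => /andP[_ /e1].
have br0 x y : x \in s -> y \in s -> ls_br g x y = 0.
  rewrite !mem_filter => /andP[Px xe] /andP[Py ye].
  have [h0 hc] := hC; have [x1 y1] := (e1 xe, e1 ye).
  have := ls_br_jacobi h0 x1 y1; rewrite (hc _ (ls_br_part x1 y1)).
  rewrite expr0 scale1r !basis_weightP // !linearZ scale_lfunE /= -scalerDl.
  by move/esym/eqP; rewrite scaler_eq0 (negPf (P0 _ _ Px Py)) => /eqP.
move=> x y xs /(@coord_span _ _ _ (in_tuple s)) ->.
rewrite linear_sum big1 // => j _.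
move: xs => /(@coord_span _ _ _ (in_tuple s)) ->.
rewrite linearZ /= linear_sum sum_lfunE big1 ?scaler0 // => i _.
by rewrite linearZ scale_lfunE /= br0 ?scaler0 ?mem_nth.
Qed.

(** Since [h] is central in g0, ad z commutes with ad h, so [z, x] involves only basis vectors of
    the same weight as [x]. *)
Lemma sign_part_normalized : even_normalized <<s>>.
Proof.
have brs z x : z \in g0 -> x \in s -> ls_br g z x \in <<s>>%VS.
  rewrite mem_filter => z0 /andP[Px xe]; have x1 := e1 xe.
  have [h0 hc] := hC; set t := ls_br g z x.
  have ht : ls_br g h t = wt x *: t.
    rewrite (ls_br_jacobi h0 z0 x1) hc // linear0 zero_lfunE add0r expr0 scale1r.
    by rewrite basis_weightP // linearZ.
  have t1 : t \in g1 by exact: (ls_br_part z0 x1).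
  have tE := coord_basis eB t1; rewrite tE memv_suml // => i _.
  have [->|ci] := eqVneq (coord e i t) 0; first by rewrite scale0r mem0v.
  rewrite memvZ // memv_span // mem_filter mem_nth ?size_tuple // andbT.
  have := congr1 (coord e i) ht; rewrite [in LHS]tE !linear_sum /=.
  rewrite (bigD1 i) //= big1 => [|j ji].
    rewrite !linearZ /= -tnth_nth he linearZ /= {1}(tnth_nth 0).
    rewrite coord_free ?(basis_free eB) // eqxx mulr1 addr0 mulrC => /(mulIf ci) ai.
    by rewrite basis_weightE ai.
  rewrite !linearZ /= -tnth_nth he linearZ /= (tnth_nth 0).
  by rewrite coord_free ?(basis_free eB) // (negPf ji) !mulr0.
move=> z x z0 /(@coord_span _ _ _ (in_tuple s)) ->.
rewrite linear_sum memv_suml // => i _.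
by rewrite linearZ memvZ // brs // mem_nth.
Qed.

End Sign.

Lemma exists_polarization : (forall i, a i \is Num.real) -> (forall i, a i != 0) ->
  exists wt' xs ys, polarization h wt' xs ys.
Proof.
move=> aR a0.
exists wt, [seq x <- e | 0 < wt x], [seq x <- e | wt x < 0]; split=> //.
(* A nonzero real number is comparable with 0, so the two sublists together exhaust the basis. *)
- rewrite -span_cat -(span_basis eB); apply: eq_span => x.
  rewrite mem_cat !mem_filter -andb_orl; apply: andb_idl => /tnthP[i ->].
  by rewrite basis_weightE orbC -real_neqr_lt // a0.
- apply: (@sign_part_abelian (fun c => 0 < c)) => c d c0 d0.
  by rewrite lt0r_neq0 // addr_gt0.
- apply: (@sign_part_abelian (fun c => c < 0)) => c d c0 d0.
  by rewrite ltr0_neq0 // -oppr_gt0 opprD addr_gt0 ?oppr_gt0.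
- exact: (@sign_part_normalized (fun c => 0 < c)).
- exact: (@sign_part_normalized (fun c => c < 0)).
- exact: (@sign_part_free (fun c => 0 < c)).
- exact: (@sign_part_free (fun c => c < 0)).
- by move=> x; rewrite mem_filter => /andP[? /basis_weightP].
- by move=> x; rewrite mem_filter => /andP[? /basis_weightP].
Qed.

End Polarize.

Theorem theorem10p4 (R : realType) (g : lieSuperalgebra R[i])
    (hg : quasireductive g)
    (hh : exists h : g,
        in_even_center h /\ acts_diagonally_on_odd_nonzero_real h)
    (M : superModule g) (hM : inF M)
    (hX : associated_variety M = [set 0%R]%classic) :
  projective_inF M.
Proof.
case: hh => h [hC [n [e [a [eB ea]]]]].
have [|||wt [xs [ys pol]]] := @exists_polarization _ g h n e (fun i => (a i)%:C%C) hC eB.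
- by move=> i; have [_] := ea i.
- by move=> i; apply/complex_realP; exists (a i).
- move=> i; have [a0 _] := ea i.
  by rewrite -[0]/(0%:C%C) (inj_eq (@complexI _)).
apply: (@polarized_projective R[i] g h wt xs ys M pol hM) => x v x1 xx x0 xv.
(* A nonzero fibre would put the nonzero [x] in the associated variety, which is {0}. A zero fibre
   says that Ker x is contained in xM, the exactness wanted. *)
have fib0 : ds_fiber M x = 0%VS.
  apply/eqP; apply: contraT => /eqP fib; case/eqP: x0.
  have : associated_variety M x by [].
  by rewrite hX.
have : (lker (sm_act M x) <= limg (sm_act M x))%VS by rewrite -diffv_eq0; apply/eqP.
by move=> /subvP/(_ v); rewrite memv_ker xv => /(_ (eqxx _))/memv_imgP[w _ ->]; exists w.
Qed.
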